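(* Let $\mathcal{X}=(X,d_X,\mu_X)$ be a compact mm-space which satisfies the Lebesgue differentiability property and whose generalized cMDS operator is trace class. Let $X_n=X_n(\omega)=\{\mathbf{x}_i(\omega),\ i=1,\dots,n\}$ be any collection of i.i.d. random variables chosen from $X$ with respect to the measure $\mu_X$, for $\omega\in\Omega$, for some probability space $\Omega$. Let $\mathcal{X}_n=\mathcal{X}_n(\omega)=(X_n,d_X|_{X_n\times X_n},\mu_{X_n})$ be the random metric measure space where $\mu_{X_n}$ is the uniform measure on $X_n$. Then, for almost every $\omega\in\Omega$, the kernels $K_{\widehat{\mathcal{X}}_n(\omega)}$ converge weakly to $K_{\widehat{\mathcal{X}}}$; that is, for each $n$ there exists a coupling $\mu_n\in\Gamma(\mu_X,\mu_{X_n})$ such that $$\Vert K_{\widehat{\mathcal X}}-K_{\widehat{\mathcal X}_n(\omega)}\Vert_{L^2(\mu_n\otimes\mu_n)}\longrightarrow0\quad\text{as }n\to\infty.$$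
   Context: A compact mm-space is a triple $\mathcal X=(X,d_X,\mu_X)$ with $(X,d_X)$ a compact metric space and $\mu_X$ a Borel probability measure on $X$ with full support. The uniform (probability) measure on a finite set $S$ is $\frac{1}{\mathrm{card}(S)}\sum_{s\in S}\delta_s$. The cMDS kernel of $\mathcal X$ is $$K_{\mathcal X}(x,x')=-\tfrac12\Big(d_X^2(x,x')-\int_X d_X^2(x,v)\,d\mu_X(v)-\int_X d_X^2(u,x')\,d\mu_X(u)+\iint_{X\times X} d_X^2(u,v)\,d\mu_X(u)\,d\mu_X(v)\Big)$$ and its generalized cMDS operator $\mathfrak{K}_{\mathcal X}:L^2(\mu_X)\to L^2(\mu_X)$ is $\mathfrak{K}_{\mathcal X}\phi=\int_X K_{\mathcal X}(\cdot,x')\phi(x')\,d\mu_X(x')$, a compact self-adjoint operator. It is trace class if the sum of the absolute values of its eigenvalues, counted with multiplicity, is finite. In that case, with positive eigenvalues $\lambda_1\ge\lambda_2\ge\cdots>0$ (with multiplicity) and corresponding orthonormal eigenfunctions $\{\phi_i\}$, the kernel of the cMDS output $\widehat{\mathcal X}$, viewed on $X\times X$, is $K_{\widehat{\mathcal X}}(x,x')=\sum_i\lambda_i\phi_i(x)\phi_i(x')$ (sum over all positive eigenvalues). The same definition applies to the finite mm-space $\mathcal X_n(\omega)$, giving $K_{\widehat{\mathcal X}_n(\omega)}$. $\Gamma(\mu,\nu)$ is the set of couplings of $\mu$ and $\nu$ (measures on the product with these marginals), and for $\mu_n\in\Gamma(\mu_X,\mu_{X_n})$, $\Vert K-L\Vert_{L^2(\mu_n\otimes\mu_n)}^2=\int\vert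 K(x,x')-L(y,y')\vert^2\,d(\mu_n\otimes\mu_n)(x,y,x',y')$. $\mathcal X$ satisfies the Lebesgue differentiability property if for every $f\in L^1(\mu_X)$, $\lim_{r\to0}\frac{1}{\mu_X(B(x,r))}\int_{B(x,r)}f\,d\mu_X=f(x)$ for $\mu_X$-a.e. $x$.
   Formalization: The uniform measure on X_n is taken as the empirical measure (1/n)∑δ_{x_i}, counting repeated points; with repetitions discarded the claim fails, e.g. for two points at distance 1 with weights 1/3 and 2/3. *)

(* Defs.v *)
From HB Require Import structures.
From mathcomp Require Import all_boot all_order all_algebra.
From mathcomp Require Import finmap.
From mathcomp Require Import all_classical all_reals all_analysis.

Set Implicit Arguments.
Unset Strict Implicit.
Unset Printing Implicit Defensive.

Import Order.TTheory GRing.Theory Num.Theory.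
Import numFieldNormedType.Exports.

Local Open Scope classical_set_scope.
Local Open Scope ring_scope.

(* Measurable types are pointed in the library, so the carrier of a metric
   measure space has to be pointed too; a space that carries a probability
   measure is nonempty, hence this loses nothing. *)
#[short(type="pmetricType")]
HB.structure Definition PointedMetric (R : numDomainType) :=
  {M of Pointed M & Metric R M}.

Definition borel {R : numDomainType} (X : pmetricType R) :
  measurableType (@open X).-sigma := g_sigma_algebraType (@open X).

Record mmSpace (R : realType) := MMSpace {
  mm_carrier :> pmetricType R ;
  mm_measure : probability (borel mm_carrier) R ;
  mm_compact : compact [set: mm_carrier] ;
  mm_full_support : forall U : set mm_carrier,
    open U -> U !=set0 -> (0 < mm_measure U)%E
}.

Section cMDS.
Context {R : realType} (X : mmSpace R).
Local Notation mu := (mm_measure X).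
Local Notation d2 x y := (mdist (x : X) (y : X) ^+ 2).
Implicit Types (f phi : X -> R) (l : R).

Definition cMDS_kernel (x x' : X) : R :=
  - 2^-1 * (d2 x x' - \int[mu]_v d2 x v - \int[mu]_u d2 u x'
            + \int[mu]_u \int[mu]_v d2 u v).

Definition cMDS_operator phi : X -> R :=
  fun x => \int[mu]_x' (cMDS_kernel x x' * phi x').

(* Elements of L^2 are represented by square-integrable functions, and
   equalities in L^2 hold almost everywhere. *)
Definition in_eigenspace l phi : Prop :=
  ((phi : borel X -> R) \in Lfun mu 2%:E) /\
  {ae mu, forall x : borel X, cMDS_operator phi x = l * phi x}.

Definition is_eigenvalue l : Prop :=
  exists phi, in_eigenspace l phi /\ ~ {ae mu, forall x : borel X, phi x = 0}.

Definition linearly_independent n (f : 'I_n -> X -> R) : Prop :=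
  forall c : 'I_n -> R,
    {ae mu, forall x : borel X, \sum_(i < n) c i * f i x = 0} ->
    forall i, c i = 0.

(* The dimension of the eigenspace of l, possibly infinite, and 0 when l is
   not an eigenvalue. *)
Definition multiplicity l : \bar R :=
  ereal_sup [set (n%:R%:E : \bar R) | n in [set n : nat |
    exists f : 'I_n -> X -> R,
      (forall i, in_eigenspace l (f i)) /\ linearly_independent f]].

Definition trace_class : Prop :=
  ((\esum_(l in [set l : R | is_eigenvalue l]) (`|l|%:E * multiplicity l))
     < +oo)%E.

(* lam enumerates the positive eigenvalues in nonincreasing order, each one
   repeated according to its multiplicity, and phi lists corresponding
   orthonormal eigenfunctions. If there are only finitely many positive
   eigenvalues, lam is continued by 0; phi i is arbitrary when lam i = 0. *)
Definition positive_eigensystem (lam : nat -> R) (phi : nat -> X -> R) : Prop :=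
  [/\ forall i, 0 <= lam i,
      forall i j, (i <= j)%N -> lam j <= lam i,
      forall i, 0 < lam i -> in_eigenspace (lam i) (phi i),
      forall i j, 0 < lam i -> 0 < lam j ->
        \int[mu]_x (phi i x * phi j x) = (i == j)%:R &
      forall l, 0 < l -> counting [set i | lam i = l] = multiplicity l].

(* The eigenfunctions are determined only up to a choice of orthonormal bases
   and of representatives, so this is a predicate on kernels. *)
Definition is_cMDS_output_kernel (K : X -> X -> R) : Prop :=
  exists (lam : nat -> R) (phi : nat -> X -> R),
    positive_eigensystem lam phi /\
    forall x x', K x x' = limn (series (fun i => lam i * phi i x * phi i x')).

Definition lebesgue_differentiability : Prop :=
  forall f, mu.-integrable setT (fun x : borel X => (f x)%:E) ->
  {ae mu, forall x : borel X,
    (fine (mu (ball (x : X) r)))^-1 * \int[mu]_(y in ball (x : X) r) f y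
      @[r --> 0^'+] --> f x}.

End cMDS.
Arguments trace_class {R} X.
Arguments lebesgue_differentiability {R} X.

Section coupling.
Context {R : realType} (X Y : mmSpace R).

Definition is_coupling (g : probability (borel X * borel Y)%type R) : Prop :=
  (forall A : set (borel X), measurable A -> g (A `*` setT) = mm_measure X A) /\
  (forall B : set (borel Y), measurable B -> g (setT `*` B) = mm_measure Y B).

Definition coupling_L2_distance (g : probability (borel X * borel Y)%type R)
    (K : X -> X -> R) (L : Y -> Y -> R) : \bar R :=
  Lnorm (g \x g)%E 2%:E
    (fun p : ((borel X * borel Y) * (borel X * borel Y))%type =>
      (K p.1.1 p.2.1 - L p.1.2 p.2.2)%:E).

End coupling.

Section sample.
Context {R : realType} (X : pmetricType R) (n : nat) (x : 'I_n.+1 -> X).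

Definition sample_type : Type := set_type (range x).

HB.instance Definition _ := Choice.on sample_type.

Definition sample_point (i : 'I_n.+1) : sample_type :=
  exist _ (x i) (mem_set (imageT x i)).

HB.instance Definition _ := isPointed.Build sample_type (sample_point ord0).

Definition sample_dist (a b : sample_type) : R := mdist (sval a) (sval b).

Fact sample_distxx a : sample_dist a a = 0.
Proof. exact: mdistxx. Qed.

Fact sample_dist_positivity a b : sample_dist a b = 0 -> a = b.
Proof. by move=> /mdist_positivity ab; exact: val_inj. Qed.

Fact sample_dist_sym a b : sample_dist a b = sample_dist b a.
Proof. exact: metric_sym. Qed.

Fact sample_dist_triangle b a c :
  sample_dist a c <= sample_dist a b + sample_dist b c.
Proof. exact: metric_triangle. Qed.

HB.instance Definition _ := @isMetric.Build R sample_type sample_dist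
  sample_distxx sample_dist_positivity sample_dist_sym sample_dist_triangle.

(* The points of the sample are counted with repetition, i.e. this is the
   empirical measure; it is the uniform measure on the set of sample points
   when the x i are pairwise distinct. *)
Definition sample_measure (A : set (borel sample_type)) : \bar R :=
  ((n.+1%:R^-1)%:E * \sum_(i < n.+1) \d_(sample_point i : borel sample_type) A)%E.

Fact sample_measureE : sample_measure =
  mscale (n.+1%:R^-1)%:nng
    (msum (fun k => \d_(sample_point (inord k) : borel sample_type)) n.+1).
Proof.
apply/funext => A; rewrite /sample_measure /mscale /msum/=; congr (_ * _)%E.
by apply: eq_bigr => i _; rewrite inord_val.
Qed.

Fact sample_measure0 : sample_measure set0 = 0%E.
Proof. by rewrite sample_measureE measure0. Qed.

Fact sample_measure_ge0 A : (0 <= sample_measure A)%E.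
Proof. by rewrite sample_measureE measure_ge0. Qed.

Fact sample_measure_sigma_additive : semi_sigma_additive sample_measure.
Proof. by rewrite sample_measureE; exact: measure_semi_sigma_additive. Qed.

HB.instance Definition _ := isMeasure.Build _ _ _ sample_measure
  sample_measure0 sample_measure_ge0 sample_measure_sigma_additive.

Fact sample_measure_setT : sample_measure setT = 1%E.
Proof.
rewrite /sample_measure; under eq_bigr do rewrite diracT.
by rewrite sumEFin sumr_const card_ord -EFinM mulVf ?pnatr_eq0.
Qed.

HB.instance Definition _ := Measure_isProbability.Build _ _ _ sample_measure
  sample_measure_setT.

Fact sample_compact : compact [set: sample_type].
Proof.
suff -> : [set: sample_type] = range sample_point.
  exact/finite_compact/finite_image/finite_finset.
apply/seteqP; split => // -[y yx] _; have [i _ xi] := set_mem yx.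
by exists i => //; exact: val_inj.
Qed.

Fact sample_full_support (U : set sample_type) :
  open U -> U !=set0 -> (0 < sample_measure U)%E.
Proof.
move=> _ [[y yx] Uy]; have [i _ xi] := set_mem yx.
have Ui : U (sample_point i).
  by rewrite (_ : sample_point i = exist _ y yx)//; exact: val_inj.
rewrite /sample_measure mule_gt0 ?lte_fin ?invr_gt0//.
rewrite (bigD1 i)//= diracE mem_set//.
by rewrite (lt_le_trans lte01)// leeDl// sume_ge0.
Qed.

Definition sample_mm : mmSpace R :=
  MMSpace sample_compact sample_full_support.

End sample.

Section iid.
Context {d d' : measure_display} {Omega : measurableType d}
  {T : measurableType d'} {R : realType} (P : probability Omega R).

Definition mutually_independent (x : nat -> {RV P >-> T}) : Prop :=
  forall (J : {fset nat}) (A : nat -> set T),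
    (forall i, measurable (A i)) ->
    P (\bigcap_(i in [set` J]) (x i @^-1` A i)) =
      (\prod_(i <- J) P (x i @^-1` A i))%E.

Definition iid (mu : probability T R) (x : nat -> {RV P >-> T}) : Prop :=
  mutually_independent x /\
  forall i (A : set T), measurable A -> distribution P (x i) A = mu A.

End iid.

(* Main.v *)
(* Taking the positive part is a contraction for the Hilbert-Schmidt norm, being
   the metric projection onto the convex cone of nonnegative operators.  Hence,
   for any coupling [g] of [X] and [Xn], the distance between the two output
   kernels in [L^2 (g \x g)] is at most the distance between the two cMDS kernels,
   which is controlled by the transport cost [W], the integral of [d(x, y)] against [g].
   Couplings with [W] tending to [0] come from partitioning [X] into finitely many
   small cells and using the law of large numbers for the mass of each cell.
   To use the contraction property one needs that [K - sum_i lam_i phi_i phi_i] is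
   nonpositive.  This is obtained from the existence of a top eigenfunction for a
   Lipschitz kernel with positive supremum of its quadratic form, applied to the
   truncations of that difference: an eigenvalue above [lam_N] would exceed the
   multiplicity recorded by the eigensystem.  The trace class hypothesis gives the
   almost everywhere convergence of the series defining the output kernel. *)
Require Import Defs.
From HB Require Import structures.
From mathcomp Require Import all_boot all_order all_algebra.
From mathcomp Require Import finmap ring lra measurable_realfun.
From mathcomp Require Import all_classical all_reals all_analysis.

Set Implicit Arguments.
Unset Strict Implicit.
Unset Printing Implicit Defensive.

Import Order.TTheory GRing.Theory Num.Theory.
Import numFieldNormedType.Exports.

Local Open Scope classical_set_scope.
Local Open Scope ring_scope.


(** * Bounded measurable functions *)

(** No spectral decomposition of the operator is used, only finite truncations of the given
    eigensystem. After removing the first [N] terms the quadratic form is at most [lam N] times the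
    squared norm, not nonpositive, so the contraction estimate holds up to an error of order
    1/(N+1), which disappears in the limit by Fatou's lemma. The 1/(N+1) comes from bounded partial
    sums of a nonincreasing sequence: for [X] they are bounded by the trace class hypothesis, for a
    sample by the weight of its atoms. The kernels of [X] and of the sample are subtracted after
    being pulled back to one space [Z] carrying the coupling. An eigenfunction of one space is then
    tested against the kernel of the other, so the bound on the form is needed for all functions on
    [Z], not only for those that factor through a projection. Eigenfunctions are given up to null
    sets; applying the operator and dividing by the eigenvalue gives Lipschitz representatives, for
    which the eigenvalue equation holds at every point. *)

Section bounded_measurable.
Context {R : realType} {d : measure_display} {T : measurableType d}.
Implicit Types f g : T -> R.

(** This class mostly stands in for square integrability: it is stable under products, sections and
    composition, and over a probability measure it makes integrability and Fubini automatic. *)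
Definition bounded_mfun f :=
  measurable_fun setT f /\ exists M : R, forall t, `|f t| <= M.

Lemma bounded_mfun_measurable f : bounded_mfun f -> measurable_fun setT f.
Proof. by case. Qed.

Lemma bounded_mfun_cst (c : R) : bounded_mfun (fun=> c).
Proof. by split => //; exists `|c|. Qed.

Lemma bounded_mfunD f g :
  bounded_mfun f -> bounded_mfun g -> bounded_mfun (fun t => f t + g t).
Proof.
move=> [mf [M fM]] [mg [N gN]]; split; first exact: measurable_funD.
by exists (M + N) => t; rewrite (le_trans (ler_normD _ _))// lerD.
Qed.

Lemma bounded_mfunM f g :
  bounded_mfun f -> bounded_mfun g -> bounded_mfun (fun t => f t * g t).
Proof.
move=> [mf [M fM]] [mg [N gN]]; split; first exact: measurable_funM.
by exists (M * N) => t; rewrite normrM ler_pM.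
Qed.

Lemma bounded_mfunZ (c : R) f : bounded_mfun f -> bounded_mfun (fun t => c * f t).
Proof. by apply: bounded_mfunM; exact: bounded_mfun_cst. Qed.

Lemma bounded_mfunN f : bounded_mfun f -> bounded_mfun (fun t => - f t).
Proof.
by move=> /(bounded_mfunZ (-1)); under eq_fun do rewrite mulN1r.
Qed.

Lemma bounded_mfunB f g :
  bounded_mfun f -> bounded_mfun g -> bounded_mfun (fun t => f t - g t).
Proof. by move=> bf /bounded_mfunN; exact: bounded_mfunD. Qed.

Lemma bounded_mfunX f n : bounded_mfun f -> bounded_mfun (fun t => f t ^+ n).
Proof.
move=> bf; elim: n => [|n ih].
  by under eq_fun do rewrite expr0; exact: bounded_mfun_cst.
by under eq_fun do rewrite exprS; exact: bounded_mfunM.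
Qed.

Lemma bounded_mfun_norm f : bounded_mfun f -> bounded_mfun (fun t => `|f t|).
Proof.
move=> [mf [M fM]]; split; first exact: measurableT_comp.
by exists M => t; rewrite normr_id.
Qed.

Lemma bounded_mfun_sum I (r : seq I) (F : I -> T -> R) :
  (forall i, bounded_mfun (F i)) -> bounded_mfun (fun t => \sum_(i <- r) F i t).
Proof.
move=> bF; elim: r => [|i r ih].
  by under eq_fun do rewrite big_nil; exact: bounded_mfun_cst.
by under eq_fun do rewrite big_cons; exact: bounded_mfunD.
Qed.

Lemma bounded_mfun_indic (A : set T) : measurable A -> bounded_mfun (\1_A : T -> R).
Proof.
move=> mA; split; first exact: measurable_indic.
by exists 1 => t; rewrite indicE; case: (t \in A); rewrite ?normr1 ?normr0.
Qed.

End bounded_measurable.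

Lemma bounded_mfun_comp {R : realType} d d' (T : measurableType d)
    (T' : measurableType d') (f : T -> R) (h : T' -> T) :
  measurable_fun setT h -> bounded_mfun f -> bounded_mfun (fun t => f (h t)).
Proof.
move=> mh [mf [M fM]]; split; first exact: measurableT_comp mf mh.
by exists M => t.
Qed.

(** * Expectations of bounded functions *)

Section expectation.
Context {R : realType} {d : measure_display} {T : measurableType d}.
Variable P : probability T R.
Implicit Types f g : T -> R.

Lemma bounded_mfun_integrable f : bounded_mfun f -> P.-integrable setT (EFin \o f).
Proof.
move=> [mf [M fM]]; apply: measurable_bounded_integrable => //.
  by rewrite (le_lt_trans (probability_le1 _ _))// ltry.
by exists M; split => [|x Mx y _ /=]; [exact: num_real|rewrite (le_trans (fM y))// ltW].
Qed.

Local Hint Resolve bounded_mfun_integrable : core.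

Lemma integral_bounded f : bounded_mfun f ->
  (\int[P]_x (f x)%:E)%E = (\int[P]_x f x)%:E.
Proof.
by move=> bf; rewrite fineK// integrable_fin_num//; exact: bounded_mfun_integrable.
Qed.

Lemma mean_cst (c : R) : \int[P]_x c = c.
Proof. by rewrite Rintegral_cst// [X in fine X](probability_setT P) mulr1. Qed.

Lemma meanD f g : bounded_mfun f -> bounded_mfun g ->
  \int[P]_x (f x + g x) = \int[P]_x f x + \int[P]_x g x.
Proof. by move=> bf bg; rewrite RintegralD//; exact: bounded_mfun_integrable. Qed.

Lemma meanB f g : bounded_mfun f -> bounded_mfun g ->
  \int[P]_x (f x - g x) = \int[P]_x f x - \int[P]_x g x.
Proof. by move=> bf bg; rewrite RintegralB//; exact: bounded_mfun_integrable. Qed.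

Lemma meanZ (c : R) f : bounded_mfun f -> \int[P]_x (c * f x) = c * \int[P]_x f x.
Proof. by move=> bf; rewrite RintegralZl//; exact: bounded_mfun_integrable. Qed.

Lemma meanZr (c : R) f : bounded_mfun f -> \int[P]_x (f x * c) = \int[P]_x f x * c.
Proof. by move=> bf; rewrite RintegralZr//; exact: bounded_mfun_integrable. Qed.

Lemma mean_sum I (r : seq I) (F : I -> T -> R) : (forall i, bounded_mfun (F i)) ->
  \int[P]_x (\sum_(i <- r) F i x) = \sum_(i <- r) \int[P]_x F i x.
Proof.
move=> bF; elim: r => [|i r ih].
  by rewrite big_nil; under eq_Rintegral do rewrite big_nil; rewrite mean_cst.
rewrite big_cons -ih -meanD//; last exact: bounded_mfun_sum.
by under eq_Rintegral do rewrite big_cons.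
Qed.

Lemma mean_le f g : bounded_mfun f -> bounded_mfun g -> (forall x, f x <= g x) ->
  \int[P]_x f x <= \int[P]_x g x.
Proof. by move=> bf bg fg; apply: le_Rintegral => //; exact: bounded_mfun_integrable. Qed.

Lemma mean_norm_le f : bounded_mfun f -> `|\int[P]_x f x| <= \int[P]_x `|f x|.
Proof. by move=> bf; apply: le_normr_Rintegral => //; exact: bounded_mfun_integrable. Qed.

Lemma mean_le_cst f (M : R) : bounded_mfun f -> (forall x, f x <= M) -> \int[P]_x f x <= M.
Proof. by move=> bf fM; rewrite -[leRHS]mean_cst mean_le//; exact: bounded_mfun_cst. Qed.

Lemma mean_norm_le_cst f (M : R) : bounded_mfun f -> (forall x, `|f x| <= M) ->
  `|\int[P]_x f x| <= M.
Proof.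
move=> bf fM; rewrite (le_trans (mean_norm_le bf))// mean_le_cst//.
exact: bounded_mfun_norm.
Qed.

Lemma mean_sqr_ge0 f : 0 <= \int[P]_x (f x ^+ 2).
Proof. by apply: Rintegral_ge0 => x _; exact: sqr_ge0. Qed.

(** The variance of [f] is nonnegative. *)
Lemma sqr_mean_le f : bounded_mfun f -> (\int[P]_x f x) ^+ 2 <= \int[P]_x (f x ^+ 2).
Proof.
move=> bf; set m := \int[P]_x f x.
have := mean_sqr_ge0 (fun x => f x - m).
have -> : \int[P]_x ((f x - m) ^+ 2) = \int[P]_x (f x ^+ 2 - ((2 * m) * f x - m ^+ 2)).
  by apply: eq_Rintegral => x _; ring.
have b2 : bounded_mfun (fun x => 2 * m * f x) by exact: bounded_mfunZ.
have bm : bounded_mfun (fun _ : T => m ^+ 2) by exact: bounded_mfun_cst.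
rewrite meanB//; [|exact: bounded_mfunX|exact: bounded_mfunB].
rewrite meanB// meanZ// mean_cst -/m; nra.
Qed.

Lemma mean_ae_eq f g : measurable_fun setT f -> measurable_fun setT g ->
  {ae P, forall x, f x = g x} -> \int[P]_x f x = \int[P]_x g x.
Proof.
move=> mf mg fg; congr fine; apply: ae_eq_integral => //; [exact/measurable_EFinP..|].
by apply: filterS fg => x ->.
Qed.

Lemma mean_pushforward d' (T' : measurableType d') (Q : probability T' R)
    (h : T -> T') (f : T' -> R) : measurable_fun setT h ->
  (forall A, measurable A -> P (h @^-1` A) = Q A) -> bounded_mfun f ->
  \int[P]_x f (h x) = \int[Q]_y f y.
Proof.
move=> mh PQ bf; rewrite /Rintegral; congr fine.
have bfh := bounded_mfun_comp mh bf.
transitivity (\int[pushforward P h]_y (f y)%:E)%E.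
  rewrite integral_pushforward//; first exact/measurable_EFinP/bounded_mfun_measurable.
  rewrite preimage_setT; exact: (bounded_mfun_integrable bfh).
by apply: eq_measure_integral => A mA _; exact: PQ.
Qed.

End expectation.

(** * Fubini for bounded functions *)

Section fubini.
Context {R : realType} {d1 d2 : measure_display}.
Context {T1 : measurableType d1} {T2 : measurableType d2}.
Variables (P1 : probability T1 R) (P2 : probability T2 R).
Implicit Type F : T1 * T2 -> R.

Lemma bounded_mfun_section1 F x : bounded_mfun F -> bounded_mfun (fun y => F (x, y)).
Proof. by apply: bounded_mfun_comp; exact: measurable_pair1. Qed.

Lemma bounded_mfun_section2 F y : bounded_mfun F -> bounded_mfun (fun x => F (x, y)).
Proof. by apply: bounded_mfun_comp; exact: measurable_pair2. Qed.

Lemma bounded_mfun_mean F :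
  bounded_mfun F -> bounded_mfun (fun x => \int[P2]_y F (x, y)).
Proof.
move=> bF; have [M FM] := bF.2; split.
  apply/measurable_EFinP.
  rewrite [X in measurable_fun _ X](_ : _ = fubini_F P2 (EFin \o F)).
    exact: (measurable_fubini_F (bounded_mfun_integrable (P1 \x P2)%E bF)).
  by apply/funext => x /=; rewrite -integral_bounded//; exact: bounded_mfun_section1.
by exists M => x; rewrite mean_norm_le_cst//; exact: bounded_mfun_section1.
Qed.

Lemma mean_prod F : bounded_mfun F ->
  \int[(P1 \x P2)%E]_p F p = \int[P1]_x \int[P2]_y F (x, y).
Proof.
move=> bF; rewrite /Rintegral; congr fine.
rewrite -(integral12_prod_meas1 (bounded_mfun_integrable (P1 \x P2)%E bF)).
apply: eq_integral => x _; rewrite /fubini_F integral_bounded//.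
exact: bounded_mfun_section1.
Qed.

Lemma mean_prod_swap F : bounded_mfun F ->
  \int[(P1 \x P2)%E]_p F p = \int[P2]_y \int[P1]_x F (x, y).
Proof.
move=> bF; rewrite /Rintegral; congr fine.
rewrite -(integral21_prod_meas1 (bounded_mfun_integrable (P1 \x P2)%E bF)).
apply: eq_integral => x _; rewrite /fubini_G integral_bounded//.
exact: bounded_mfun_section2.
Qed.

End fubini.

(** * Compact metric spaces *)

Lemma measurable_fun_lt {R : realType} d (T : measurableType d) (f : T -> R) :
  (forall r : R, measurable [set x | f x < r]) -> measurable_fun setT f.
Proof.
move=> mf; apply: (measurability _ (RGenInftyO.measurableE R)).
move=> _ [_ [r ->] <-]; rewrite setTI.
by have := mf r; congr (measurable _); apply/seteqP; split=> x /=; rewrite in_itv.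
Qed.

Lemma measurable_lt_set {R : realType} d (T : measurableType d) (f : T -> R) (r : R) :
  measurable_fun setT f -> measurable [set x | f x < r].
Proof.
move=> /(_ measurableT _ (measurable_itv `]-oo, r[)); rewrite setTI.
by congr (measurable _); apply/seteqP; split=> x /=; rewrite in_itv.
Qed.

Section compact_metric.
Context {R : realType} (X : pmetricType R).
Hypothesis cX : compact [set: X].
Implicit Types (x y : X) (f : X -> R) (e r L : R).

Definition lipschitz_fun L f := forall x y, `|f x - f y| <= L * mdist x y.

Lemma open_lipschitz_lt L f r : lipschitz_fun L f -> open [set x | f x < r].
Proof.
move=> lf; rewrite openE => x /= fxr.
have L0 : 0 < `|L| + 1 by rewrite ltr_wpDl.
apply/nbhs_ballP; exists ((r - f x) / (`|L| + 1)).
  by rewrite /= divr_gt0// subr_gt0.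
move=> y; rewrite ballEmdist/= ltr_pdivlMr// => xy.
have := lf x y; rewrite distrC => /ler_normlW.
have := ler_norm L; have := mdist_ge0 x y; nra.
Qed.

Lemma measurable_lipschitz L f : lipschitz_fun L f ->
  measurable_fun setT (f : borel X -> R).
Proof.
move=> lf; apply: measurable_fun_lt => r.
by apply: sub_sigma_algebra; exact: open_lipschitz_lt lf.
Qed.

Lemma lipschitz_mdistr x : lipschitz_fun 1 (mdist x).
Proof.
move=> y z; rewrite mul1r ler_norml.
have := metric_triangle x y z; have := metric_triangle x z y.
rewrite (metric_sym z y) => *; apply/andP; split; lra.
Qed.

Lemma lipschitzZ (c : R) L f : lipschitz_fun L f ->
  lipschitz_fun (`|c| * L) (fun x => c * f x).
Proof.
by move=> lf x y; rewrite -mulrBr normrM -mulrA ler_wpM2l.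
Qed.

Lemma open_mdist_lt x r : open [set y | mdist x y < r].
Proof. exact: open_lipschitz_lt (lipschitz_mdistr x). Qed.

Lemma finite_net e : 0 < e ->
  exists s : seq X, forall x, exists2 c, c \in s & mdist c x < e.
Proof.
move=> e0; move: cX; rewrite compact_cover => /(_ X setT (fun c => [set y | mdist c y < e])).
case=> [c _|x _|D _ DX]; first exact: open_mdist_lt.
  by exists x => //=; rewrite mdistxx.
by exists D => x; have [c cD xc] := DX x I; exists c.
Qed.

Lemma mdist_bounded : exists D : R, 0 < D /\ forall x y, mdist x y <= D.
Proof.
have [s sP] := finite_net (@ltr01 R).
(* The double sum dominates every distance between points of the 1-net, and 2 pays for moving both
   [x] and [y] to the net. *)
exists (2 + \sum_(c <- s) \sum_(c' <- s) mdist c c'); split.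
  by rewrite ltr_wpDr// !sumr_ge0// => *; rewrite sumr_ge0// => *; exact: mdist_ge0.
move=> x y; have [c cs cx] := sP x; have [c' cs' cy] := sP y.
have : mdist c c' <= \sum_(c <- s) \sum_(c' <- s) mdist c c'.
  rewrite (big_rem c)//= (big_rem c')//= -addrA lerDl addr_ge0 ?sumr_ge0//.
    by move=> *; exact: mdist_ge0.
  by move=> *; rewrite sumr_ge0// => *; exact: mdist_ge0.
have := metric_triangle x c y; have := metric_triangle c c' y.
rewrite (metric_sym x c) => *; lra.
Qed.

(** Measurability is for the product of the two Borel sigma-algebras, so openness in the product
    space does not settle it. The sublevel set is a countable union, over the points [c] of finite
    nets of mesh 1/(k+1), of sets defined by a sum of one-variable functions. *)
Lemma measurable_mdist :
  measurable_fun setT (fun p : (borel X * borel X)%type => mdist (p.1 : X) (p.2 : X)).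
Proof.
have e0 k : 0 < k.+1%:R^-1 :> R by rewrite invr_gt0.
have /choice[net netP] : forall k : nat, exists s : seq X,
    forall x, exists2 c, c \in s & mdist c x < k.+1%:R^-1.
  by move=> k; exact: finite_net.
apply: measurable_fun_lt => r.
rewrite (_ : mkset _ = \bigcup_k \bigcup_(c in [set` net k])
    [set p : (borel X * borel X)%type | mdist c (p.1 : X) + mdist c (p.2 : X) < r]).
  apply: bigcupT_measurable => k; apply: fin_bigcup_measurable => // c _.
  apply: measurable_lt_set.
  by apply: measurable_funD; apply: (measurableT_comp (measurable_lipschitz (@lipschitz_mdistr c))).
apply/seteqP; split => [[x y]/= xyr|[x y]/= [k _ [c _ /= cr]]]; last first.
  by have := metric_triangle x c y; rewrite (metric_sym x c); lra.
(* Half the gap suffices, since d(c,x) + d(c,y) <= 2 d(c,x) + d(x,y). *)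
have r0 : 0 < (r - mdist x y) / 2 by rewrite divr_gt0// subr_gt0.
have [k _ kr] := near_infty_natSinv_lt (PosNum r0).
have {}kr : k.+1%:R^-1 < (r - mdist x y) / 2 by exact: (kr k (leqnn k)).
have [c cs cx] := netP k x; exists k => //; exists c => //=.
have := metric_triangle c x y; move: (k.+1%:R^-1) cx kr => t cx kr. lra.
Qed.

End compact_metric.

(** * Integral operators on bounded functions *)

Ltac bmf := repeat first
  [ assumption | exact: bounded_mfun_cst | apply: bounded_mfunD | apply: bounded_mfunB
  | apply: bounded_mfunN | apply: bounded_mfunM | apply: bounded_mfunX
  | apply: bounded_mfun_norm ].

Section integral_operator.
Context {R : realType} {d : measure_display} {Z : measurableType d}.
Variable nu : probability Z R.
Variables (g : Z * Z -> R) (M : R).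
Hypotheses (bg : bounded_mfun g) (gM : forall p, `|g p| <= M)
  (gC : forall x y, g (x, y) = g (y, x)).
Implicit Types f h : Z -> R.

Definition inner f h : R := \int[nu]_z (f z * h z).

Definition kernel_op f : Z -> R := fun z => \int[nu]_z' (g (z, z') * f z').

Definition kernel_form f : R := inner (kernel_op f) f.

Lemma innerC f h : inner f h = inner h f.
Proof. by apply: eq_Rintegral => z _; rewrite mulrC. Qed.

Lemma innerDl f1 f2 h : bounded_mfun f1 -> bounded_mfun f2 -> bounded_mfun h ->
  inner (fun z => f1 z + f2 z) h = inner f1 h + inner f2 h.
Proof.
move=> b1 b2 bh; rewrite /inner -meanD; [|by bmf..].
by apply: eq_Rintegral => z _; rewrite mulrDl.
Qed.

Lemma innerZl c f h : bounded_mfun f -> bounded_mfun h ->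
  inner (fun z => c * f z) h = c * inner f h.
Proof.
move=> bf bh; rewrite /inner -meanZ; [|by bmf].
by apply: eq_Rintegral => z _; rewrite mulrA.
Qed.

Lemma innerDr f1 f2 h : bounded_mfun f1 -> bounded_mfun f2 -> bounded_mfun h ->
  inner h (fun z => f1 z + f2 z) = inner h f1 + inner h f2.
Proof. by move=> *; rewrite innerC innerDl// !(innerC h). Qed.

Lemma innerZr c f h : bounded_mfun f -> bounded_mfun h ->
  inner h (fun z => c * f z) = c * inner h f.
Proof. by move=> *; rewrite innerC innerZl// (innerC h). Qed.

Lemma inner_ge0 f : 0 <= inner f f.
Proof. by apply: Rintegral_ge0 => z _; rewrite -expr2 sqr_ge0. Qed.

Lemma bounded_mfun_kernel_op f : bounded_mfun f -> bounded_mfun (kernel_op f).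
Proof.
move=> bf; apply: (@bounded_mfun_mean _ _ _ _ _ nu nu (fun p => g p * f p.2)).
by apply: bounded_mfunM => //; apply: (bounded_mfun_comp _ bf); exact: measurable_snd.
Qed.

Let bmf_sec z : bounded_mfun (fun z' => g (z, z')).
Proof. exact: bounded_mfun_section1. Qed.

Lemma kernel_opD f1 f2 : bounded_mfun f1 -> bounded_mfun f2 ->
  kernel_op (fun z => f1 z + f2 z) = (fun z => kernel_op f1 z + kernel_op f2 z).
Proof.
move=> b1 b2; apply/funext => z; rewrite /kernel_op -meanD; [|exact: bounded_mfunM..].
by apply: eq_Rintegral => z' _; rewrite mulrDr.
Qed.

Lemma kernel_opZ c f : bounded_mfun f ->
  kernel_op (fun z => c * f z) = (fun z => c * kernel_op f z).
Proof.
move=> bf; apply/funext => z; rewrite /kernel_op -meanZ; last exact: bounded_mfunM.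
by apply: eq_Rintegral => z' _; rewrite mulrCA.
Qed.

Lemma inner_kernel_op f h : bounded_mfun f -> bounded_mfun h ->
  inner (kernel_op f) h = inner f (kernel_op h).
Proof.
move=> bf bh; pose F (p : Z * Z) := g p * f p.2 * h p.1.
have bF : bounded_mfun F.
  apply: bounded_mfunM; [apply: bounded_mfunM => //|].
    by apply: (bounded_mfun_comp _ bf); exact: measurable_snd.
  by apply: (bounded_mfun_comp _ bh); exact: measurable_fst.
transitivity (\int[(nu \x nu)%E]_p F p).
  rewrite mean_prod//; apply: eq_Rintegral => z _.
  by rewrite -meanZr//; exact: bounded_mfunM.
rewrite mean_prod_swap//; apply: eq_Rintegral => z _.
rewrite -meanZ; last exact: bounded_mfunM.
by apply: eq_Rintegral => z' _; rewrite /F/= gC; ring.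
Qed.

Lemma kernel_op_le f z : bounded_mfun f -> `|kernel_op f z| <= M * \int[nu]_z `|f z|.
Proof.
move=> bf; rewrite (le_trans (mean_norm_le _ _))//; first by bmf.
rewrite -meanZ; last by bmf.
have M0 : 0 <= M by rewrite (le_trans _ (gM (z, z))).
apply: mean_le; [by bmf|by apply: bounded_mfunZ; bmf|] => z'.
by rewrite normrM ler_wpM2r.
Qed.

Lemma sqr_mean_norm_le f : bounded_mfun f -> (\int[nu]_z `|f z|) ^+ 2 <= inner f f.
Proof.
move=> bf; rewrite (le_trans (sqr_mean_le _ _))//; first by bmf.
rewrite le_eqVlt; apply/orP; left; apply/eqP.
by apply: eq_Rintegral => z _; rewrite real_normK ?num_real// expr2.
Qed.

Lemma kernel_bound_ge0 : 0 <= M.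
Proof. by rewrite (le_trans _ (gM (point, point))). Qed.

Lemma kernel_form_le f : bounded_mfun f -> `|kernel_form f| <= M * inner f f.
Proof.
move=> bf; have bT := bounded_mfun_kernel_op bf.
rewrite (le_trans (mean_norm_le _ _))//; first by bmf.
apply: (@le_trans _ _ (M * (\int[nu]_z `|f z|) ^+ 2)); last first.
  by rewrite ler_wpM2l ?kernel_bound_ge0// sqr_mean_norm_le.
rewrite expr2 mulrA -meanZ; last by bmf.
apply: mean_le; [by bmf|by apply: bounded_mfunZ; bmf|] => z.
by rewrite normrM ler_wpM2r// kernel_op_le.
Qed.

Lemma kernel_formZ c f : bounded_mfun f ->
  kernel_form (fun z => c * f z) = c ^+ 2 * kernel_form f.
Proof.
move=> bf; have bT := bounded_mfun_kernel_op bf.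
rewrite /kernel_form kernel_opZ// innerZl//; last exact: bounded_mfunZ.
by rewrite innerZr// mulrA.
Qed.

Lemma kernel_formD f h : bounded_mfun f -> bounded_mfun h ->
  kernel_form (fun z => f z + h z) =
  kernel_form f + 2 * inner (kernel_op f) h + kernel_form h.
Proof.
move=> bf bh; have bTf := bounded_mfun_kernel_op bf; have bTh := bounded_mfun_kernel_op bh.
rewrite /kernel_form kernel_opD// innerDl; [|by bmf..].
rewrite innerDr; [|by bmf..]; rewrite innerDr; [|by bmf..].
rewrite (inner_kernel_op bh bf) (innerC h); ring.
Qed.

(* Cauchy-Schwarz for the nonnegative form [m <f, f> - <T f, f>]. *)
Lemma residual_le (m : R) f : 0 < m ->
  (forall f, bounded_mfun f -> kernel_form f <= m * inner f f) -> bounded_mfun f ->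
  inner (fun z => m * f z - kernel_op f z) (fun z => m * f z - kernel_op f z) <=
  (m + M) * (m * inner f f - kernel_form f).
Proof.
move=> m0 qm bf; have bTf := bounded_mfun_kernel_op bf.
set h := fun z => _; have bh : bounded_mfun h.
  by apply: bounded_mfunB => //; exact: bounded_mfunZ.
have mM : 0 < m + M by rewrite ltr_wpDr// kernel_bound_ge0.
(* The form at [f + t h] is at most q(f) + 2 t N + t^2 (m + M) N, where q is the nonnegative form
   and N = <h, h>; this [t] minimises the bound. *)
pose t := - (m + M)^-1.
have bth : bounded_mfun (fun z => t * h z) by exact: bounded_mfunZ.
have ineq := qm _ (bounded_mfunD bf bth).
rewrite kernel_formD// kernel_formZ// innerDl in ineq; [|by bmf..].
rewrite !innerDr in ineq; [|by bmf..].
rewrite !innerZr// !innerZl// in ineq.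
move: ineq.
have : inner h h = m * inner f h - inner (kernel_op f) h.
  rewrite {1}(_ : h = (fun z => m * f z + (- 1) * kernel_op f z)).
    rewrite innerDl ?innerZl ?mulN1r//; by apply: bounded_mfunZ.
  by apply/funext => z; rewrite /h mulN1r.
have := kernel_form_le bh; rewrite ler_norml => /andP[+ _].
rewrite (innerC h f).
set N := inner h h; set a := inner f f; set b := inner f h; set k := inner _ h.
set Q := kernel_form f; set q := kernel_form h => Nq NE.
have tE : t * (m + M) = -1 by rewrite mulNr mulVf// gt_eqF.
move=> ineq.
have : 0 <= m * a - Q + 2 * t * N + t ^+ 2 * ((m + M) * N).
  have : t ^+ 2 * (- (M * N)) <= t ^+ 2 * q by rewrite ler_wpM2l// sqr_ge0.
  move: ineq; rewrite NE; nra.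
have -> : t ^+ 2 * ((m + M) * N) = - (t * N).
  by rewrite expr2 -mulrA (mulrA t (m + M)) tE mulN1r mulrN.
move=> H; have {H} : 0 <= (m * a - Q) + t * N by lra.
move=> /(ler_wpM2l (ltW mM)); rewrite mulr0 mulrDr mulrA (mulrC (m + M) t) tE mulN1r.
by rewrite subr_ge0.
Qed.

(** [m] is the supremum of the form over the unit ball. It need not be attained by a bounded
    function, but [residual_le] turns almost maximal value into almost satisfied eigenvalue
    equation. *)
Lemma approximate_top_eigenfunction (l : R) f0 : 0 <= l -> bounded_mfun f0 ->
  l * inner f0 f0 < kernel_form f0 ->
  exists2 m, l < m & forall e, 0 < e -> exists f,
    [/\ bounded_mfun f, inner f f <= 1, m - e < kernel_form f &
        inner (fun z => m * f z - kernel_op f z) (fun z => m * f z - kernel_op f z) <= e].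
Proof.
move=> l0 b0 lq.
pose S := [set q | exists f, [/\ bounded_mfun f, inner f f <= 1 & q = kernel_form f]].
have M0 := kernel_bound_ge0.
have form_null f : bounded_mfun f -> inner f f = 0 -> kernel_form f = 0.
  by move=> bf f0'; apply/eqP; rewrite -normr_le0 (le_trans (kernel_form_le bf))// f0' mulr0.
have norm1 f : bounded_mfun f -> inner f f != 0 -> exists f', [/\ bounded_mfun f',
    inner f' f' <= 1 & kernel_form f' = kernel_form f / inner f f].
  move=> bf fn0; have f_gt0 : 0 < inner f f by rewrite lt_neqAle eq_sym fn0 inner_ge0.
  exists (fun z => (Num.sqrt (inner f f))^-1 * f z); split; first exact: bounded_mfunZ.
    rewrite innerZl ?innerZr//; last exact: bounded_mfunZ.
    by rewrite mulrA -expr2 exprVn sqr_sqrtr ?inner_ge0// mulVf.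
  by rewrite kernel_formZ// exprVn sqr_sqrtr ?inner_ge0// mulrC.
have f0n0 : inner f0 f0 != 0.
  by apply: contraPneq lq => /[dup] /form_null -> // ->; rewrite mulr0 ltxx.
have f0_gt0 : 0 < inner f0 f0 by rewrite lt_neqAle eq_sym f0n0 inner_ge0.
have [f1 [b1 n1 q1]] := norm1 _ b0 f0n0.
have supS : has_sup S.
  split; first by exists (kernel_form f1), f1.
  exists M => _ [f [bf nf ->]]; rewrite (le_trans (ler_norm _))//.
  by rewrite (le_trans (kernel_form_le bf))// ler_piMr.
pose m := sup S.
have lm : l < m.
  apply: (@lt_le_trans _ _ (kernel_form f1)); first by rewrite q1 ltr_pdivlMr.
  by apply: sup_upper_bound => //; exists f1.
have m0 : 0 < m := le_lt_trans l0 lm.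
have qm f : bounded_mfun f -> kernel_form f <= m * inner f f.
  move=> bf; have [f_0|fn0] := eqVneq (inner f f) 0.
    by rewrite form_null// f_0 mulr0.
  have [f' [bf' nf' qf']] := norm1 _ bf fn0.
  have f_gt0 : 0 < inner f f by rewrite lt_neqAle eq_sym fn0 inner_ge0.
  by rewrite -ler_pdivrMr// -qf'; apply: sup_upper_bound => //; exists f'.
exists m => // e e0.
have mM : 0 < m + M by rewrite ltr_wpDr.
(* The first entry controls the value of the form; the second absorbs the factor [m + M] of
   [residual_le]. *)
have e'0 : 0 < Num.min e (e / (m + M)) by rewrite lt_min e0 divr_gt0.
have [_ [f [bf nf ->]] qf] := sup_adherent e'0 supS.
exists f; split => //.
  by rewrite (le_lt_trans _ qf)// lerB// ge_min lexx.
rewrite (le_trans (residual_le m0 qm bf))// mulrC -ler_pdivlMr//.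
have : m - e / (m + M) < kernel_form f.
  by rewrite (le_lt_trans _ qf)// lerB// ge_min lexx orbT.
have : m * inner f f <= m by rewrite ler_piMr// ltW.
by lra.
Qed.

End integral_operator.

(** * Top eigenfunctions of Lipschitz kernels *)

Lemma lipschitz_bounded_mfun {R : realType} (X : pmetricType R) (L M : R) (f : X -> R) :
  lipschitz_fun L f -> (forall x, `|f x| <= M) -> bounded_mfun (f : borel X -> R).
Proof. by move=> lf fM; split; [exact: measurable_lipschitz lf|exists M]. Qed.

Definition lipschitz_kernel {R : realType} (X : pmetricType R) (M L : R)
    (G : X -> X -> R) :=
  [/\ forall x y, G x y = G y x, forall x y, `|G x y| <= M,
      forall z, lipschitz_fun L (G^~ z) &
      measurable_fun setT (fun p : (borel X * borel X)%type => G p.1 p.2)].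

Lemma ultra_fmap (T U : Type) (f : T -> U) (F : set_system T) :
  UltraFilter F -> UltraFilter (f @ F).
Proof.
move=> FU; have FF : ProperFilter F by exact: ultra_proper.
split; first exact: fmap_proper_filter.
move=> G GF FG; apply/seteqP; split => // A GA.
have [//|FA] := in_ultra_setVsetC (f @^-1` A) FU.
have /FG GcA : (f @ F) (~` A) by [].
by have [x []] := filter_ex (filterI GA GcA).
Qed.

(** A form of Arzela-Ascoli without subsequences: [v] is the pointwise limit along an ultrafilter
    refining the eventual filter, and the common Lipschitz constant makes closeness on a finite net
    into uniform closeness. *)
Lemma uniform_cluster {R : realType} (X : pmetricType R) (L M : R) (u : nat -> X -> R) :
  compact [set: X] -> (forall n, lipschitz_fun L (u n)) ->
  (forall n x, `|u n x| <= M) -> exists v : X -> R,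
  [/\ lipschitz_fun L v, forall x, `|v x| <= M &
      forall e N, 0 < e -> exists2 n, (N <= n)%N & forall x, `|u n x - v x| <= e].
Proof.
move=> cX lu uM.
have [U [UU FU]] := ultraFilterLemma (@eventually_filter).
have UF : ProperFilter U by exact: ultra_proper.
have /choice[v vP] : forall x, exists l : R, u n x @[n --> U] --> l.
  move=> x; have := segment_compact (a := - M) (b := M).
  rewrite compact_ultra => /(_ _ (ultra_fmap (u^~ x) UU))[].
  - by apply: (@filterE _ U) => n; rewrite /= in_itv/= -ler_norml uM.
  - by move=> l [_ ?]; exists l.
have vU x e : 0 < e -> \forall n \near U, `|u n x - v x| < e.
  move=> e0; have /cvgrPdist_lt/(_ _ e0) := vP x.
  by apply: filterS => n; rewrite distrC.
have lv : lipschitz_fun L v.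
  move=> x y; apply/ler_addgt0Pr => e e0.
  have e20 : 0 < e / 2 by rewrite divr_gt0.
  have [n [nx ny]] := filter_ex (filterI (vU x _ e20) (vU y _ e20)).
  have := lu n x y; move: nx ny; rewrite !ltr_norml !ler_norml.
  by move=> /andP[? ?] /andP[? ?] /andP[? ?]; apply/andP; split; lra.
exists v; split => //.
  move=> x; apply/ler_addgt0Pr => e e0; have [n nx] := filter_ex (vU x _ e0).
  have := uM n x; move: nx; rewrite !ltr_norml !ler_norml.
  by move=> /andP[? ?] /andP[? ?]; apply/andP; split; lra.
move=> e N e0.
(* One third of [e] for the error at the net point and one for each of the moves of [u n] and [v]
   from it; the [+ 1] avoids a zero divisor. *)
pose r := e / 3 / (`|L| + 1).
have L0 : 0 < `|L| + 1 by rewrite ltr_wpDl.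
have r0 : 0 < r by rewrite !divr_gt0.
have Lr : `|L| * r <= e / 3.
  by rewrite mulrCA ler_piMr ?divr_ge0 ?ltW// ltr_pdivrMr ?mul1r ?ltrDl.
have [s sP] := finite_net cX r0.
have e30 : 0 < e / 3 by rewrite divr_gt0.
have sU : \forall n \near U, forall c, c \in s -> `|u n c - v c| < e / 3.
  elim: s {sP} => [|c s ih]; first by apply: filterE.
  apply: filterS2 (vU c _ e30) ih => n nc ns c'.
  by rewrite inE => /predU1P[->|/ns].
have NU : \forall n \near U, (N <= n)%N by apply: FU; exact: nbhs_infty_ge.
have [n [ns Nn]] := filter_ex (filterI sU NU).
exists n => // x; have [c cs cx] := sP x.
have cLr : L * mdist c x <= e / 3.
  rewrite (le_trans _ Lr)// (@le_trans _ _ (`|L| * mdist c x))//.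
    by rewrite ler_wpM2r ?mdist_ge0// ler_norm.
  by rewrite ler_wpM2l// ltW.
have := le_trans (lu n c x) cLr; have := le_trans (lv c x) cLr.
move: (ns c cs); rewrite !ler_norml ltr_norml.
by move=> /andP[? ?] /andP[? ?] /andP[? ?]; apply/andP; split; lra.
Qed.

Section top_eigenfunction.
Context {R : realType} (X : mmSpace R).
Local Notation mu := (mm_measure X).
Context {d : measure_display} {Z : measurableType d} (nu : probability Z R).
Variable pi : Z -> X.
Hypotheses (mpi : measurable_fun setT (pi : Z -> borel X))
  (nupi : forall A : set (borel X), measurable A -> nu (pi @^-1` A) = mu A).

Definition pullback_kernel (G : X -> X -> R) (p : Z * Z) : R := G (pi p.1) (pi p.2).

Lemma mean_pullback (f : X -> R) : bounded_mfun (f : borel X -> R) ->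
  \int[nu]_z f (pi z) = \int[mu]_x f x.
Proof. by move=> bf; rewrite (mean_pushforward mpi nupi). Qed.

Lemma bounded_mfun_pullback (G : borel X -> borel X -> R) M :
  measurable_fun setT (fun p : (borel X * borel X)%type => G p.1 p.2) ->
  (forall x y, `|G x y| <= M) -> bounded_mfun (pullback_kernel G).
Proof.
move=> mG GM; split; last by exists M => p; exact: GM.
have mp : measurable_fun setT
    (fun p : Z * Z => (pi p.1 : borel X, pi p.2 : borel X)).
  apply: measurable_fun_pair; first exact: measurableT_comp mpi measurable_fst.
  exact: measurableT_comp mpi measurable_snd.
exact: measurableT_comp mG mp.
Qed.

(** The test function lives on [Z], yet the eigenfunction lives on [X]: the pulled back operator
    only produces functions of [pi z]. Its values on almost maximisers are equi-Lipschitz on [X],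
    and a uniform cluster point of them solves the eigenvalue equation everywhere. *)
Lemma top_eigenfunction (G : X -> X -> R) M L (l : R) f0 :
  lipschitz_kernel M L G -> 0 <= l -> bounded_mfun f0 ->
  l * inner nu f0 f0 < kernel_form nu (pullback_kernel G) f0 ->
  exists m u, [/\ l < m, lipschitz_fun L u, forall x, `|u x| <= M,
    forall x, \int[mu]_y (G x y * u y) = m * u x & 0 < \int[mu]_x (u x ^+ 2)].
Proof.
move=> [GC GM GL mG] l0 b0 lq.
have bG := bounded_mfun_pullback mG GM.
have [m lm mP] := approximate_top_eigenfunction bG (fun p => GM _ _)
  (fun x y => GC _ _) l0 b0 lq.
have m0 : 0 < m := le_lt_trans l0 lm.
pose t n : R := n.+1%:R^-1.
have t0 n : 0 < t n by rewrite invr_gt0.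
have t1 n : t n <= 1 by rewrite invf_le1// ler1n.
(* With tolerance [t n ^+ 2] on the squared norm, the residual has norm at most [t n]. *)
have /choice[f fP] : forall n, exists f : Z -> R, [/\ bounded_mfun f, inner nu f f <= 1,
    m - t n ^+ 2 < kernel_form nu (pullback_kernel G) f &
    inner nu (fun z => m * f z - kernel_op nu (pullback_kernel G) f z)
      (fun z => m * f z - kernel_op nu (pullback_kernel G) f z) <= t n ^+ 2].
  by move=> n; apply: mP; exact: exprn_gt0.
have M0 : 0 <= M by rewrite (le_trans _ (GM point point)).
have bGG : bounded_mfun (fun p : (borel X * borel X)%type => G p.1 p.2).
  by split => //; exists M.
have bGX x : bounded_mfun (G x : borel X -> R) :=
  bounded_mfun_section1 (x : borel X) bGG.
have bGx x : bounded_mfun (fun z => G x (pi z)) := bounded_mfun_comp mpi (bGX x).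
have f1 n : \int[nu]_z `|f n z| <= 1.
  have [bf nf _ _] := fP n.
  rewrite -(@ler_pXn2r _ 2)// ?nnegrE ?Rintegral_ge0// expr1n.
  by rewrite (le_trans _ nf)// sqr_mean_norm_le.
pose u n x := \int[nu]_z (G x (pi z) * f n z).
have lu n : lipschitz_fun L (u n).
  move=> x y; have [bf _ _ _] := fP n.
  rewrite /u -meanB; [|by bmf..].
  rewrite (le_trans (mean_norm_le _ _)); [by []|by bmf|].
  have Lxy : 0 <= L * mdist x y by rewrite (le_trans _ (GL point x y)).
  apply: (@le_trans _ _ (\int[nu]_z (L * mdist x y * `|f n z|))).
    apply: mean_le; [by bmf|by apply: bounded_mfunZ; bmf|] => z.
    by rewrite -mulrBl normrM ler_wpM2r// GL.
  by rewrite meanZ; [rewrite ler_piMr|by bmf].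
have uM n x : `|u n x| <= M.
  have [bf _ _ _] := fP n.
  rewrite (le_trans (mean_norm_le _ _)); [by []|by bmf|].
  apply: (@le_trans _ _ (\int[nu]_z (M * `|f n z|))).
    apply: mean_le; [by bmf|by apply: bounded_mfunZ; bmf|] => z.
    by rewrite normrM ler_wpM2r.
  by rewrite meanZ; [rewrite ler_piMr|by bmf].
have [v [lv vM uv]] := uniform_cluster (@mm_compact _ X) lu uM.
have bv : bounded_mfun (v : borel X -> R) := lipschitz_bounded_mfun lv vM.
have bu n : bounded_mfun (u n : borel X -> R) := lipschitz_bounded_mfun (lu n) (uM n).
have close e : 0 < e -> exists n, t n <= e /\ forall x, `|u n x - v x| <= e.
  move=> e0; have [N _ NP] := near_infty_natSinv_lt (PosNum e0).
  have [n Nn nP] := uv e N e0; exists n; split => //.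
  by rewrite ltW//; exact: NP.
have buz n : bounded_mfun (fun z => u n (pi z)) := bounded_mfun_comp mpi (bu n).
have bvz : bounded_mfun (fun z => v (pi z)) := bounded_mfun_comp mpi bv.
exists m, v; split => //.
- move=> x; rewrite -(mean_pullback (bounded_mfunM (bGX x) bv)).
  apply/eqP; rewrite -subr_eq0 -normr_le0; apply/ler_addgt0Pr => e e0.
  (* The error has three parts: [M e'] from the residual of [f n], [M e'] from replacing [u n] by
     [v] under the integral, and [m e'] from replacing it outside. *)
  have C0 : 0 < 2 * M + m by rewrite ltr_wpDl// mulr_ge0.
  rewrite add0r.
  have [n [tn nv]] := close _ (divr_gt0 e0 C0).
  have [bf nf _ rf] := fP n.
  set e' := e / _ in tn nv.
  have Ee : e = (2 * M + m) * e' by rewrite mulrC divfK// gt_eqF.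
  have hle : `|\int[nu]_z (G x (pi z) * (m * f n z - u n (pi z)))| <= M * e'.
    have bh : bounded_mfun (fun z => m * f n z - u n (pi z)).
      by apply: bounded_mfunB => //; exact: bounded_mfunZ.
    rewrite (le_trans (mean_norm_le _ _)); [by []|by bmf|].
    apply: (@le_trans _ _ (\int[nu]_z (M * `|m * f n z - u n (pi z)|))).
      apply: mean_le; [by bmf|by apply: bounded_mfunZ; bmf|] => z.
      by rewrite normrM ler_wpM2r.
    rewrite meanZ ?ler_wpM2l//; last by bmf.
    rewrite (le_trans _ tn)// -(@ler_pXn2r _ 2)// ?nnegrE ?Rintegral_ge0//; last first.
      exact: ltW.
    by rewrite (le_trans (sqr_mean_norm_le _ bh)).
  have hE : \int[nu]_z (G x (pi z) * (m * f n z - u n (pi z))) =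
      m * u n x - \int[nu]_z (G x (pi z) * u n (pi z)).
    transitivity (\int[nu]_z (m * (G x (pi z) * f n z) - G x (pi z) * u n (pi z))).
      by apply: eq_Rintegral => z _; rewrite mulrBr mulrCA.
    rewrite meanB; [|by apply: bounded_mfunZ; bmf|by bmf].
    by rewrite meanZ//; bmf.
  have vle : `|\int[nu]_z (G x (pi z) * (v (pi z) - u n (pi z)))| <= M * e'.
    apply: mean_norm_le_cst; first by bmf.
    by move=> z; rewrite normrM ler_pM// distrC.
  have vE : \int[nu]_z (G x (pi z) * (v (pi z) - u n (pi z))) =
      \int[nu]_z (G x (pi z) * v (pi z)) - \int[nu]_z (G x (pi z) * u n (pi z)).
    rewrite -meanB; [|by bmf..].
    by apply: eq_Rintegral => z _; rewrite mulrBr.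
  have mle : `|m * u n x - m * v x| <= m * e'.
    by rewrite -mulrBr normrM gtr0_norm// ler_wpM2l// ltW.
  move: hle vle mle; rewrite hE vE Ee !ler_norml.
  by move=> /andP[? ?] /andP[? ?] /andP[? ?]; apply/andP; split; lra.
(* The limit is not null: the form at [f n] is almost [m], which gives U > m^2 - 2 m e, and V >= U -
   2 M e. The summand 1 leaves V > e > 0. *)
- have C0 : 0 < 2 * m + 2 * M + 1 by rewrite ltr_wpDl// addr_ge0// mulr_ge0// ltW.
  have [n [tn nv]] := close _ (divr_gt0 (exprn_gt0 2 m0) C0).
  have [bf nf qf _] := fP n.
  set e := m ^+ 2 / _ in tn nv.
  have Ee : m ^+ 2 = (2 * m + 2 * M + 1) * e by rewrite mulrC divfK// gt_eqF.
  (* Young's inequality a b <= a^2 / (2 m) + m b^2 / 2 with a = u n and b = f n. *)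
  have : kernel_form nu (pullback_kernel G) (f n) <=
      (2 * m)^-1 * \int[mu]_x (u n x ^+ 2) + m / 2 * inner nu (f n) (f n).
    rewrite -(mean_pullback (bounded_mfunX 2 (bu n))).
    rewrite -!meanZ; [|by bmf..]; rewrite -meanD; [|by bmf..].
    apply: mean_le; [by apply: bounded_mfunM; [exact: buz|bmf]|by bmf|] => z.
    rewrite [kernel_op _ _ _ _](_ : _ = u n (pi z))//.
    have := sqr_ge0 (u n (pi z) - m * f n z).
    rewrite -(@ler_pM2l _ (2 * m)^-1) ?invr_gt0 ?mulr_gt0// mulr0.
    rewrite sqrrB exprMn !mulrDr.
    have -> : (2 * m)^-1 * (m ^+ 2 * f n z ^+ 2) = m / 2 * (f n z * f n z) by field; rewrite gt_eqF.
    have -> : (2 * m)^-1 * (- (u n (pi z) * (m * f n z) *+ 2)) = - (u n (pi z) * f n z).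
      by field; rewrite gt_eqF.
    by lra.
  have : \int[mu]_x (u n x ^+ 2) <= \int[mu]_x (v x ^+ 2) + 2 * M * e.
    rewrite -lerBlDl -meanB; [|by bmf..].
    apply: mean_le_cst => [|x]; first by bmf.
    rewrite subr_sqr mulrC (le_trans (ler_norm _))// normrM ler_pM//.
    by rewrite (le_trans (ler_normD _ _))// mulr_natl mulr2n lerD.
  set U := \int[mu]_x (u n x ^+ 2); set V := \int[mu]_x (v x ^+ 2) => UV.
  move=> qU; have {qU}: m - t n ^+ 2 < (2 * m)^-1 * U + m / 2.
    rewrite (lt_le_trans qf)// (le_trans qU)// lerD2l ler_piMr// divr_ge0// ltW//.
  rewrite -(@ltr_pM2l _ (2 * m)) ?mulr_gt0// [ltRHS]mulrDr mulVKf ?gt_eqF ?mulr_gt0//.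
  have -> : 2 * m * (m / 2) = m ^+ 2 by field.
  have : t n ^+ 2 <= e by rewrite (le_trans _ tn)// expr2 ler_piMl// ltW.
  have e0 : 0 < e by rewrite divr_gt0// exprn_gt0.
  move: Ee UV; rewrite expr2; nra.
Qed.

End top_eigenfunction.

(** * The cMDS kernel *)

Section square_integrable.
Context {R : realType} {d : measure_display} {T : measurableType d}.
Variable P : probability T R.
Implicit Types f g : T -> R.

Lemma Lfun2_bounded f : bounded_mfun f -> f \in Lfun P 2%:E.
Proof.
move=> bf; rewrite inE; apply/andP; split; rewrite inE/=; first exact: bf.1.
rewrite /finite_norm unlock poweR_lty//.
have := bounded_mfun_integrable P (bounded_mfunX 2 (bounded_mfun_norm bf)).
move=> /integrableP[_]; apply: le_lt_trans.
rewrite le_eqVlt; apply/orP; left; apply/eqP; apply: eq_integral => x _.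
by rewrite /= powR_mulrn// normrX normr_id.
Qed.

Lemma Lfun2_measurable f : f \in Lfun P 2%:E -> measurable_fun setT f.
Proof. by rewrite inE => /andP[]; rewrite inE. Qed.

Lemma Lfun2_integrable f : f \in Lfun P 2%:E -> P.-integrable setT (EFin \o f).
Proof.
move=> f2; apply/Lfun1_integrable.
by apply: Lfun_subset12 f2; exact: fin_num_measure.
Qed.

Lemma Lfun2_bounded_mul f g : bounded_mfun f -> g \in Lfun P 2%:E ->
  P.-integrable setT (EFin \o (fun x => f x * g x)).
Proof.
by move=> /Lfun2_bounded f2 g2; apply/Lfun1_integrable; exact: Lfun2_mul_Lfun1.
Qed.

End square_integrable.

Section cMDS_kernel.
Context {R : realType} (X : mmSpace R).
Local Notation mu := (mm_measure X).
Local Notation d2 x y := (mdist (x : X) (y : X) ^+ 2).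

Lemma bounded_mfun_mdist :
  bounded_mfun (fun p : (borel X * borel X)%type => mdist (p.1 : X) (p.2 : X)).
Proof.
split; first exact: (measurable_mdist (@mm_compact _ X)).
have [D [_ DX]] := mdist_bounded (@mm_compact _ X).
by exists D => p; rewrite ger0_norm ?mdist_ge0.
Qed.

Let b2 := bounded_mfunX 2 bounded_mfun_mdist.

Let b2r x : bounded_mfun (fun v : borel X => d2 x v) :=
  bounded_mfun_section1 (x : borel X) b2.

Lemma mean_sqr_mdistC x' : \int[mu]_u d2 u x' = \int[mu]_u d2 x' u.
Proof. by apply: eq_Rintegral => u _; rewrite metric_sym. Qed.

Lemma sqr_mdist_le D : (forall x y : X, mdist x y <= D) -> 0 < D ->
  forall x x' y y' : X, `|d2 x x' - d2 y y'| <= 2 * D * (mdist x y + mdist x' y').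
Proof.
move=> DX D0 x x' y y'; rewrite subr_sqr normrM.
rewrite mulrC ler_pM//.
  rewrite ger0_norm ?addr_ge0 ?mdist_ge0//.
  by rewrite mulr_natl mulr2n lerD.
rewrite ler_norml; have := metric_triangle x y x'; have := metric_triangle y y' x'.
have := metric_triangle y x y'; have := metric_triangle x x' y'.
rewrite (metric_sym y x) (metric_sym y' x') => *; apply/andP; split; lra.
Qed.

Lemma lipschitz_cMDS_kernel :
  exists M L : R, 0 < L /\ lipschitz_kernel M L (cMDS_kernel (X := X)).
Proof.
have [D [D0 DX]] := mdist_bounded (@mm_compact _ X).
have d2D x y : 0 <= d2 x y <= D ^+ 2.
  by rewrite sqr_ge0/= ler_sqr ?nnegrE ?mdist_ge0// ltW.
have aD x : 0 <= \int[mu]_v d2 x v <= D ^+ 2.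
  rewrite mean_sqr_ge0; apply: mean_le_cst => // v.
  by have /andP[] := d2D x v.
have ba : bounded_mfun (fun x : borel X => \int[mu]_v d2 x v).
  exact: (bounded_mfun_mean mu mu b2).
have cD : 0 <= \int[mu]_u \int[mu]_v d2 u v <= D ^+ 2.
  apply/andP; split; first by apply: Rintegral_ge0 => u _; exact: mean_sqr_ge0.
  by apply: mean_le_cst => // u; have /andP[] := aD u.
have aL x y : `|\int[mu]_v d2 x v - \int[mu]_v d2 y v| <= 2 * D * mdist x y.
  rewrite -meanB//; apply: mean_norm_le_cst; first by apply: bounded_mfunB; exact: b2r.
  by move=> v; rewrite (le_trans (sqr_mdist_le DX D0 _ _ _ _))// mdistxx addr0.
(* All four terms of the kernel lie in [0, D^2]. In one variable only two of them vary, each with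
   Lipschitz constant 2 D, and the factor 1/2 averages them. *)
exists (2 * D ^+ 2), (2 * D); split; first by rewrite mulr_gt0.
split.
- move=> x y; rewrite /cMDS_kernel !mean_sqr_mdistC (metric_sym x y); ring.
- move=> x y; rewrite /cMDS_kernel mean_sqr_mdistC.
  move: (d2D x y) (aD x) (aD y) cD; rewrite ler_norml.
  by move=> /andP[? ?] /andP[? ?] /andP[? ?] /andP[? ?]; apply/andP; split; lra.
- move=> z x y; rewrite /cMDS_kernel mean_sqr_mdistC.
  have := sqr_mdist_le DX D0 x z y z; rewrite mdistxx addr0.
  move: (aL x y); rewrite !ler_norml.
  by move=> /andP[? ?] /andP[? ?]; apply/andP; split; lra.
- rewrite /cMDS_kernel; apply: measurable_funM => //.
  apply: measurable_funD => //; apply: measurable_funB; first apply: measurable_funB.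
  + exact: b2.1.
  + exact: (measurableT_comp ba.1 measurable_fst).
  + under eq_fun do rewrite mean_sqr_mdistC.
    exact: (measurableT_comp ba.1 measurable_snd).
Qed.

Lemma bounded_mfun_cMDS_kernel (x : X) :
  bounded_mfun (cMDS_kernel x : borel X -> R).
Proof.
have [M [L [_ [_ KM _ mK]]]] := lipschitz_cMDS_kernel.
have bK : bounded_mfun (fun p : (borel X * borel X)%type => cMDS_kernel (p.1 : X) (p.2 : X)).
  by split => //; exists M.
exact: (bounded_mfun_section1 (x : borel X) bK).
Qed.

(** The bounds of the kernel are multiplied by the L^1 norm of [phi], finite because [mu] is a
    probability. *)
Lemma lipschitz_cMDS_operator phi : (phi : borel X -> R) \in Lfun mu 2%:E ->
  exists M L, lipschitz_fun L (cMDS_operator phi) /\ forall x, `|cMDS_operator phi x| <= M.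
Proof.
move=> phi2; have [M [L [L0 [_ KM KL mK]]]] := lipschitz_cMDS_kernel.
have iphi := Lfun2_integrable phi2.
have inphi : mu.-integrable setT (EFin \o (fun x : borel X => `|phi x|)).
  exact: (integrable_norm iphi).
have iK x : mu.-integrable setT (EFin \o (fun y : borel X => cMDS_kernel x y * phi y)).
  by apply: Lfun2_bounded_mul phi2; exact: bounded_mfun_cMDS_kernel.
exists (M * \int[mu]_x `|phi x|), (L * \int[mu]_x `|phi x|); split.
  move=> x y; rewrite /cMDS_operator -RintegralB//.
  have i1 : mu.-integrable setT
      (EFin \o (fun z : borel X => cMDS_kernel x z * phi z - cMDS_kernel y z * phi z)).
    exact: (integrableB _ (iK x) (iK y)).
  rewrite (le_trans (le_normr_Rintegral _ i1))//.
  rewrite -mulrA (mulrC (\int[mu]_x _)) mulrA -RintegralZl//.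
  apply: le_Rintegral => //.
  - exact: (integrable_norm i1).
  - exact: (integrableZl _ _ inphi).
  - by move=> z _; rewrite -mulrBl normrM ler_wpM2r// KL.
move=> x; rewrite /cMDS_operator (le_trans (le_normr_Rintegral _ (iK x)))//.
rewrite -RintegralZl//; apply: le_Rintegral => //.
- exact: (integrable_norm (iK x)).
- exact: (integrableZl _ _ inphi).
- by move=> z _; rewrite normrM ler_wpM2r// KM.
Qed.

(** Null sets do not affect the integral at any fixed [x], hence equality at every point. This is
    how the eigenvalue equation of the Lipschitz representatives comes to hold everywhere. *)
Lemma cMDS_operator_ae phi psi : measurable_fun setT (phi : borel X -> R) ->
  measurable_fun setT (psi : borel X -> R) ->
  {ae mu, forall x : borel X, phi x = psi x} -> cMDS_operator phi = cMDS_operator psi.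
Proof.
move=> mphi mpsi ae; apply/funext => x.
have [mK _] := bounded_mfun_cMDS_kernel x.
apply: (@mean_ae_eq _ _ (borel X)); [exact: measurable_funM..|].
by apply: filterS ae => y ->.
Qed.

End cMDS_kernel.

(** * Deflation *)

Section eigensystem.
Context {R : realType} (X : mmSpace R).
Local Notation mu := (mm_measure X).
Variables (lam : nat -> R) (phi : nat -> X -> R).
Hypothesis sys : positive_eigensystem lam phi.

(* The everywhere defined Lipschitz representative of [phi i], and [0] if [lam i = 0]. *)
Definition smooth_eigenfunction i : X -> R :=
  locked (fun x => (lam i)^-1 * cMDS_operator (phi i) x).

Lemma smooth_eigenfunctionE i x :
  smooth_eigenfunction i x = (lam i)^-1 * cMDS_operator (phi i) x.
Proof. by rewrite /smooth_eigenfunction -lock. Qed.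

Local Notation psi := smooth_eigenfunction.

Let lam_ge0 i : 0 <= lam i. Proof. by case: sys. Qed.

Let lam_nonincr i j : (i <= j)%N -> lam j <= lam i. Proof. by case: sys => _ + _ _ _; apply. Qed.

Let lam_gt0 i : lam i != 0 -> 0 < lam i.
Proof. by move=> li; rewrite lt_neqAle eq_sym li lam_ge0. Qed.

Let phi2 i : 0 < lam i -> (phi i : borel X -> R) \in Lfun mu 2%:E.
Proof. by case: sys => _ _ + _ _ => /(_ i) /[apply] -[]. Qed.

Lemma smooth_eigenfunction0 i x : lam i = 0 -> psi i x = 0.
Proof. by rewrite smooth_eigenfunctionE => ->; rewrite invr0 mul0r. Qed.

Lemma smooth_eigenfunction_ae i : 0 < lam i ->
  {ae mu, forall x : borel X, phi i x = psi i x}.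
Proof.
move=> li; case: sys => _ _ /(_ i li)[_ e] _ _.
by apply: filterS e => x; rewrite smooth_eigenfunctionE => ->; rewrite mulKf// gt_eqF.
Qed.

Lemma lipschitz_smooth_eigenfunction i :
  exists M L, lipschitz_fun L (psi i) /\ forall x, `|psi i x| <= M.
Proof.
have [l0|l0] := eqVneq (lam i) 0.
  by exists 0, 0; split => [x y|x]; rewrite !smooth_eigenfunction0// ?subr0 normr0// mul0r.
have [M [L [Lf Mf]]] := lipschitz_cMDS_operator (phi2 (lam_gt0 l0)).
exists (`|(lam i)^-1| * M), (`|(lam i)^-1| * L); split.
  by move=> x y; rewrite !smooth_eigenfunctionE; exact: lipschitzZ.
by move=> x; rewrite smooth_eigenfunctionE normrM ler_wpM2l.
Qed.

Lemma bounded_mfun_smooth_eigenfunction i : bounded_mfun (psi i : borel X -> R).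
Proof.
have [M [L [Lf Mf]]] := lipschitz_smooth_eigenfunction i.
exact: lipschitz_bounded_mfun Lf Mf.
Qed.

Let bpsi := bounded_mfun_smooth_eigenfunction.

Lemma cMDS_operator_smooth i x : cMDS_operator (psi i) x = lam i * psi i x.
Proof.
have [l0|l0] := eqVneq (lam i) 0.
  rewrite l0 mul0r /cMDS_operator -[RHS](@mean_cst _ _ _ mu 0).
  by apply: eq_Rintegral => y _; rewrite smooth_eigenfunction0// mulr0.
have li := lam_gt0 l0.
rewrite [in RHS]smooth_eigenfunctionE mulrA divff// mul1r.
congr (_ x); apply: cMDS_operator_ae.
- exact: (bpsi i).1.
- exact: Lfun2_measurable (phi2 li).
- by apply: filterS (smooth_eigenfunction_ae li) => y ->.
Qed.

Lemma smooth_eigenfunction_orthonormal i j : 0 < lam i -> 0 < lam j ->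
  \int[mu]_x (psi i x * psi j x) = (i == j)%:R.
Proof.
move=> li lj; case: sys => _ _ _ <-// _.
apply: (@mean_ae_eq _ _ (borel X)).
- by apply: measurable_funM; exact: (bpsi _).1.
- by apply: measurable_funM; exact: Lfun2_measurable (phi2 _).
- by apply: filterS2 (smooth_eigenfunction_ae li) (smooth_eigenfunction_ae lj) => x -> ->.
Qed.

Lemma in_eigenspace_smooth i : 0 < lam i -> in_eigenspace (lam i) (psi i).
Proof.
move=> li; split; first exact: (Lfun2_bounded _ (bpsi i)).
by apply/nearW => x; rewrite cMDS_operator_smooth.
Qed.

Lemma counting_le (s : seq nat) (A : set nat) : (forall i, A i -> i \in s) ->
  (counting A <= (size s)%:R%:E :> \bar R)%E.
Proof.
move=> As; have fA : finite_set A by apply: (@sub_finite_set _ _ [set` s]).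
rewrite /counting asboolT// lee_fin ler_nat.
by apply: uniq_leq_size; [exact: fset_uniq|move=> i; rewrite in_fset_set// inE => /As].
Qed.

Lemma counting_ge (s : seq nat) (A : set nat) : uniq s -> (forall i, i \in s -> A i) ->
  ((size s)%:R%:E <= counting A :> \bar R)%E.
Proof.
move=> us sA; rewrite /counting; case: ifPn => [/asboolP fA|_]; last exact: leey.
rewrite lee_fin ler_nat; apply: uniq_leq_size => // i /sA Ai.
by rewrite in_fset_set// inE.
Qed.

(** By monotonicity the indices with eigenvalue [m] all lie below [N]. If [u] were not null,
    adjoining it to their eigenfunctions would give an orthogonal family of nonzero elements of the
    eigenspace with one member more than the multiplicity allows. *)
Lemma orthogonal_eigenfunction_eq0 (N : nat) (m : R) (u : X -> R) : lam N < m ->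
  bounded_mfun (u : borel X -> R) -> (forall x, cMDS_operator u x = m * u x) ->
  (forall i, (i < N)%N -> 0 < lam i -> \int[mu]_x (u x * psi i x) = 0) ->
  \int[mu]_x (u x ^+ 2) = 0.
Proof.
move=> lNm bu um uorth; apply/eqP/negPn/negP => u2.
have m0 : 0 < m := le_lt_trans (lam_ge0 N) lNm.
pose s := [seq i <- iota 0 N | lam i == m].
have sP i : lam i = m -> i \in s.
  move=> im; rewrite mem_filter im eqxx mem_iota/= add0n ltnNge.
  by apply/negP => /lam_nonincr; rewrite im leNgt lNm.
have sN i : i \in s -> (i < N)%N /\ lam i = m.
  by rewrite mem_filter mem_iota => /andP[/eqP -> /andP[]].
have us : uniq s by rewrite filter_uniq// iota_uniq.
(* The default value of [nth] places [u] at the last index. *)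
pose f (j : 'I_(size s).+1) : X -> R := nth u [seq psi i | i <- s] j.
have fE (j : 'I_(size s).+1) : (j < size s)%N -> f j = psi (nth 0%N s j).
  by move=> js; rewrite /f (nth_map 0%N).
have fu (j : 'I_(size s).+1) : (size s <= j)%N -> f j = u.
  by move=> sj; rewrite /f nth_default// size_map.
have bf j : bounded_mfun (f j : borel X -> R).
  by have [js|js] := ltnP j (size s); [rewrite fE//; exact: bpsi|rewrite fu].
have eigf j : in_eigenspace m (f j).
  have [js|js] := ltnP j (size s); last first.
    rewrite fu//; split; first exact: (Lfun2_bounded _ bu).
    by apply/nearW => x; rewrite um.
  have [_ im] := sN _ (mem_nth 0%N js).
  by rewrite fE// -{1}im; apply: in_eigenspace_smooth; rewrite im.
have forth i j : i != j -> \int[mu]_x (f i x * f j x) = 0.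
  move=> ij; have [js|js] := ltnP j (size s); have [ls|ls] := ltnP i (size s).
  - have [_ im] := sN _ (mem_nth 0%N ls); have [_ jm] := sN _ (mem_nth 0%N js).
    rewrite !fE// smooth_eigenfunction_orthonormal ?im ?jm//.
    by rewrite nth_uniq// (negbTE (ij : val i != val j)).
  - have [jN jm] := sN _ (mem_nth 0%N js).
    by rewrite (fE j)// (fu i)// uorth// jm.
  - have [jN jm] := sN _ (mem_nth 0%N ls).
    under eq_Rintegral do rewrite mulrC.
    by rewrite (fE i)// (fu j)// uorth// jm.
  - case/eqP: ij; apply/val_inj => /=.
    have := ltn_ord i; have := ltn_ord j; rewrite !ltnS => a b.
    by apply/eqP; rewrite eqn_leq (leq_trans b)// (leq_trans a).
have fn0 i : \int[mu]_x (f i x * f i x) != 0.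
  have [ls|ls] := ltnP i (size s).
    have [_ im] := sN _ (mem_nth 0%N ls).
    by rewrite fE// smooth_eigenfunction_orthonormal ?im// eqxx oner_neq0.
  by rewrite fu//; move: u2; under [in X in X -> _]eq_Rintegral do rewrite expr2.
have lif : linearly_independent f.
  move=> c c0 i; apply/eqP; move: (fn0 i).
  suff : c i * \int[mu]_x (f i x * f i x) = 0.
    by move/eqP; rewrite mulf_eq0 => /orP[//|->].
  have <- : \int[mu]_x ((\sum_(j < (size s).+1) c j * f j x) * f i x) = 0.
    rewrite -[RHS](@mean_cst _ _ _ mu 0); apply: (@mean_ae_eq _ _ (borel X)) => //.
      apply: (measurable_funM _ (bf i).1).
      by apply: (bounded_mfun_sum _ _).1 => j; exact: bounded_mfunZ.
    by apply: filterS c0 => x ->; rewrite mul0r.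
  transitivity (\int[mu]_x (\sum_(j < (size s).+1) (c j * (f j x * f i x)))); last first.
    apply: eq_Rintegral => x _; rewrite mulr_suml; apply: eq_bigr => j _.
    by rewrite mulrA.
  rewrite mean_sum; last by move=> j; apply: bounded_mfunZ; apply: bounded_mfunM.
  rewrite (bigD1 i)//= big1 ?addr0; last first.
    by move=> j ji; rewrite meanZ ?forth ?mulr0//; exact: bounded_mfunM.
  by rewrite meanZ//; exact: bounded_mfunM.
have : ((size s).+1%:R%:E <= multiplicity X m)%E.
  by apply: ereal_sup_ubound; exists (size s).+1 => //; exists f.
case: sys => _ _ _ _ /(_ m m0) <-; apply/negP; rewrite -ltNge.
by rewrite (le_lt_trans (counting_le sP))// lte_fin ltr_nat.
Qed.

Section deflation.
Context {d : measure_display} {Z : measurableType d} (nu : probability Z R).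
Variable pi : Z -> X.
Hypotheses (mpi : measurable_fun setT (pi : Z -> borel X))
  (nupi : forall A : set (borel X), measurable A -> nu (pi @^-1` A) = mu A).

Definition truncated_kernel N (x y : X) : R := \sum_(i < N) lam i * psi i x * psi i y.

Definition deflated_kernel N (x y : X) : R := cMDS_kernel x y - truncated_kernel N x y.

Lemma lipschitz_deflated_kernel N : exists M L, lipschitz_kernel M L (deflated_kernel N).
Proof.
elim: N => [|N [M [L [KC KM KL mK]]]].
  have [M [L [_ KL]]] := lipschitz_cMDS_kernel X; exists M, L.
  rewrite (_ : deflated_kernel 0 = cMDS_kernel (X := X))//.
  by apply/funext => x; apply/funext => y; rewrite /deflated_kernel /truncated_kernel big_ord0 subr0.
have [M' [L' [Lf Mf]]] := lipschitz_smooth_eigenfunction N.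
have KE x y : deflated_kernel N.+1 x y = deflated_kernel N x y - lam N * psi N x * psi N y.
  by rewrite /deflated_kernel /truncated_kernel big_ord_recr/= opprD addrA.
exists (M + lam N * M' * M'), (L + lam N * L' * M'); split.
- by move=> x y; rewrite !KE KC; ring.
- move=> x y; rewrite KE (le_trans (ler_normB _ _))// lerD//.
  rewrite (normrM (lam N * _)) (normrM (lam N)) ger0_norm//.
  by apply: ler_pM => //; [exact: mulr_ge0|exact: ler_wpM2l].
- move=> z x y; rewrite !KE.
  have -> : deflated_kernel N x z - lam N * psi N x * psi N z -
    (deflated_kernel N y z - lam N * psi N y * psi N z) =
    (deflated_kernel N x z - deflated_kernel N y z) - lam N * (psi N x - psi N y) * psi N z by ring.
  rewrite (le_trans (ler_normB _ _))// mulrDl lerD//; first exact: KL.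
  rewrite (normrM (lam N * _)) (normrM (lam N)) ger0_norm// -(mulrA (lam N) L') -mulrA -mulrA ler_wpM2l//.
  rewrite mulrAC ler_pM//; exact: Lf.
- under eq_fun do rewrite KE.
  apply: measurable_funB => //; apply: measurable_funM; first apply: measurable_funM => //.
  + exact: (measurableT_comp (bpsi N).1 measurable_fst).
  + exact: (measurableT_comp (bpsi N).1 measurable_snd).
Qed.

Lemma mean_truncated_kernel N x (f : X -> R) : bounded_mfun (f : borel X -> R) ->
  \int[mu]_y (truncated_kernel N x y * f y) =
  \sum_(i < N) lam i * psi i x * \int[mu]_y (f y * psi i y).
Proof.
move=> bf; transitivity (\int[mu]_y (\sum_(i < N) (lam i * psi i x) * (f y * psi i y))).
  apply: eq_Rintegral => y _; rewrite /truncated_kernel mulr_suml.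
  by apply: eq_bigr => i _; ring.
rewrite mean_sum; last by move=> i; apply: bounded_mfunZ; exact: bounded_mfunM.
by apply: eq_bigr => i _; rewrite meanZ//; exact: bounded_mfunM.
Qed.

Lemma bounded_mfun_truncated_kernel N :
  bounded_mfun (fun p : (borel X * borel X)%type => truncated_kernel N p.1 p.2).
Proof.
apply: bounded_mfun_sum => i; apply: bounded_mfunM; first apply: bounded_mfunZ.
  by apply: (bounded_mfun_comp _ (bpsi i)); exact: measurable_fst.
by apply: (bounded_mfun_comp _ (bpsi i)); exact: measurable_snd.
Qed.

Lemma mean_deflated_kernel N x (f : X -> R) : bounded_mfun (f : borel X -> R) ->
  \int[mu]_y (deflated_kernel N x y * f y) =
  cMDS_operator f x - \sum_(i < N) lam i * psi i x * \int[mu]_y (f y * psi i y).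
Proof.
move=> bf; rewrite -mean_truncated_kernel//.
have bK := bounded_mfun_cMDS_kernel x.
have bT := bounded_mfun_section1 (x : borel X) (bounded_mfun_truncated_kernel N).
rewrite -meanB; [|exact: bounded_mfunM..].
by apply: eq_Rintegral => y _; rewrite mulrBl.
Qed.

Lemma mean_deflated_eigenfunction N x j : (j < N)%N -> 0 < lam j ->
  \int[mu]_y (deflated_kernel N x y * psi j y) = 0.
Proof.
move=> jN lj; rewrite mean_deflated_kernel// cMDS_operator_smooth.
rewrite (bigD1 (Ordinal jN))//= big1 ?addr0; last first.
  move=> i; rewrite -val_eqE/= => ij; have [l0|l0] := eqVneq (lam i) 0.
    by rewrite l0 !mul0r.
  rewrite smooth_eigenfunction_orthonormal//; last exact: lam_gt0.
  by rewrite eq_sym (negbTE ij) mulr0.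
by rewrite smooth_eigenfunction_orthonormal// eqxx mulr1 subrr.
Qed.

(** Otherwise the deflated operator has an eigenfunction [u] with eigenvalue m > lam N. It kills
    [psi i] for i < N with positive eigenvalue, so by symmetry [u] is orthogonal to these; the
    removed terms then vanish on [u], which is thus an eigenfunction of the original operator as
    well, against [orthogonal_eigenfunction_eq0]. *)
Lemma deflated_kernel_form_le N (f : Z -> R) : bounded_mfun f ->
  kernel_form nu (pullback_kernel pi (deflated_kernel N)) f <= lam N * inner nu f f.
Proof.
move=> bf; rewrite leNgt; apply/negP => lf.
have [M [L KP]] := lipschitz_deflated_kernel N.
have [m [u [lm Lu uM um u2]]] := top_eigenfunction mpi nupi KP (lam_ge0 N) bf lf.
have m0 : 0 < m := le_lt_trans (lam_ge0 N) lm.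
have bu := lipschitz_bounded_mfun Lu uM.
case: KP => KC KM _ mK.
have bG : bounded_mfun (fun p : (borel X * borel X)%type => deflated_kernel N p.1 p.2).
  by split => //; exists M.
have uorth i : (i < N)%N -> 0 < lam i -> \int[mu]_x (u x * psi i x) = 0.
  move=> iN li; have := @inner_kernel_op _ _ (borel X) mu _ bG (fun x y => KC _ _) u (psi i) bu (bpsi i).
  rewrite (_ : kernel_op _ _ (u : borel X -> R) = fun x => m * u x); last exact/funext.
  rewrite (_ : kernel_op _ _ (psi i : borel X -> R) = fun=> 0); last first.
    by apply/funext => x; exact: mean_deflated_eigenfunction.
  rewrite innerZl// /inner; under [RHS]eq_Rintegral do rewrite mulr0.
  by rewrite mean_cst => /eqP; rewrite mulf_eq0 gt_eqF//= => /eqP.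
have := orthogonal_eigenfunction_eq0 lm bu _ uorth; move: u2 => /[swap] -> //; first by rewrite ltxx.
move=> x; rewrite -um mean_deflated_kernel// big1 ?subr0// => i _.
have [l0|l0] := eqVneq (lam i) 0; first by rewrite l0 !mul0r.
by rewrite uorth ?lam_gt0// mulr0.
Qed.

End deflation.
End eigensystem.

(** * Sums of eigenvalues *)

Section sum_eigenvalues.
Context {R : realType} (X : mmSpace R).
Local Notation mu := (mm_measure X).
Variables (lam : nat -> R) (phi : nat -> X -> R).
Hypothesis sys : positive_eigensystem lam phi.
Local Notation psi := (smooth_eigenfunction lam phi).

Let lam_ge0 i : 0 <= lam i. Proof. by case: sys. Qed.

Let bpsi := bounded_mfun_smooth_eigenfunction sys.

(** A partial sum is regrouped by distinct positive values; each value occurs at most as often as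
    its multiplicity. *)
Lemma sum_eigenvalues_trace_class : trace_class X ->
  exists C, forall N, \sum_(i < N) lam i <= C.
Proof.
rewrite /trace_class; set S := (\esum_(l in _) _)%E => Soo.
have S0 : (0 <= S)%E.
  apply: esum_ge0 => l _; rewrite mule_ge0//.
  (* The empty family shows that a multiplicity is nonnegative. *)
  by apply: ereal_sup_ubound => //=; exists 0%N => //; exists (fun i _ => 0); split => [[]|c _ []].
exists (fine S) => N; rewrite -lee_fin fineK ?ge0_fin_numE//.
pose r := [seq i <- iota 0 N | 0 < lam i].
pose V := undup (map lam r).
have V0 l : l \in V -> 0 < l.
  by rewrite mem_undup => /mapP[i]; rewrite mem_filter => /andP[? _] ->.
have -> : \sum_(i < N) lam i = \sum_(l <- V) (size [seq i <- r | lam i == l])%:R * l.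
  transitivity (\sum_(i <- r) lam i).
    rewrite big_filter -(big_mkord xpredT lam) /index_iota subn0 [RHS]big_mkcond/=.
    apply: eq_bigr => i _; case: ifPn => //; rewrite -leNgt => li.
    by apply/eqP; rewrite eq_le li lam_ge0.
  transitivity (\sum_(i <- r) \sum_(l <- V) (lam i == l)%:R * l).
    rewrite !big_seq; apply: eq_bigr => i ir.
    rewrite (bigD1_seq (lam i)) ?undup_uniq//=; last by rewrite mem_undup map_f.
    rewrite eqxx mul1r big1 ?addr0// => l /negbTE li.
    by rewrite eq_sym li mul0r.
  rewrite exchange_big/=; apply: eq_bigr => l _.
  rewrite -mulr_suml -sum1_size big_filter natr_sum [in RHS]big_mkcond/=.
  by congr (_ * _); apply: eq_bigr => i _; case: eqP.
have mV l : l \in V ->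
    (((size [seq i <- r | lam i == l])%:R * l)%:E <= `|l|%:E * multiplicity X l)%E.
  move=> lV; have l0 := V0 l lV.
  case: sys => _ _ _ _ /(_ l l0) <-.
  rewrite gtr0_norm// EFinM muleC lee_pmul2l// ?lte_fin//.
  apply: counting_ge; first by rewrite !filter_uniq// iota_uniq.
  by move=> i; rewrite mem_filter => /andP[/eqP].
rewrite -sumEFin.
apply: (@le_trans _ _ (\sum_(l <- V) (`|l|%:E * multiplicity X l))%E).
  by rewrite [leLHS]big_seq [leRHS]big_seq; apply: lee_sum => l; exact: mV.
apply: esum_ge; exists [set` V].
  split; [exact: finite_seq|move=> l /= lV].
  have : l \in V by []. rewrite mem_undup => /mapP[i].
  rewrite mem_filter => /andP[li _] ->.
  exists (psi i); split; first exact: in_eigenspace_smooth.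
  move=> psi0; have := smooth_eigenfunction_orthonormal sys li li.
  rewrite eqxx (@mean_ae_eq _ _ (borel X) mu _ (fun=> 0))//.
  - by rewrite mean_cst => /esym/eqP; rewrite oner_eq0.
  - by apply: measurable_funM; exact: (bpsi i).1.
  - by apply: filterS psi0 => x ->; rewrite mul0r.
rewrite fsbig_seq//; exact: undup_uniq.
Qed.

(** The [psi i] are orthonormal apart from those that vanish identically, where [lam i = 0]; the
    claim is that [f] minus its projection [g] has nonnegative squared norm. *)
Lemma bessel N (f : X -> R) : bounded_mfun (f : borel X -> R) ->
  \sum_(i < N) (\int[mu]_x (f x * psi i x)) ^+ 2 <= \int[mu]_x (f x ^+ 2).
Proof.
move=> bf; pose a i := \int[mu]_x (f x * psi i x).
have a0 i : lam i = 0 -> a i = 0.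
  move=> l0; rewrite /a -[RHS](@mean_cst _ _ _ mu 0).
  by apply: eq_Rintegral => y _; rewrite smooth_eigenfunction0// mulr0.
pose g x := \sum_(i < N) a i * psi i x.
have bg : bounded_mfun (g : borel X -> R).
  by apply: bounded_mfun_sum => i; exact: bounded_mfunZ.
have gh (h : X -> R) : bounded_mfun (h : borel X -> R) ->
    \int[mu]_x (g x * h x) = \sum_(i < N) a i * \int[mu]_x (h x * psi i x).
  move=> bh; transitivity (\int[mu]_x (\sum_(i < N) a i * (h x * psi i x))).
    apply: eq_Rintegral => x _; rewrite mulr_suml; apply: eq_bigr => i _.
    by rewrite mulrAC mulrA.
  rewrite mean_sum; last by move=> i; apply: bounded_mfunZ; exact: bounded_mfunM.
  by apply: eq_bigr => i _; rewrite meanZ//; exact: bounded_mfunM.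
have gpsi (j : 'I_N) : \int[mu]_x (g x * psi j x) = a j.
  have [l0|l0] := eqVneq (lam j) 0.
    rewrite a0// -[RHS](@mean_cst _ _ _ mu 0).
    by apply: eq_Rintegral => y _; rewrite smooth_eigenfunction0// mulr0.
  have lj : 0 < lam j by rewrite lt_neqAle eq_sym l0 lam_ge0.
  rewrite gh// (bigD1 j)//= big1 ?addr0.
    by rewrite smooth_eigenfunction_orthonormal// eqxx mulr1.
  move=> i ij; have [li|li] := eqVneq (lam i) 0; first by rewrite a0// mul0r.
  rewrite smooth_eigenfunction_orthonormal//; last by rewrite lt_neqAle eq_sym li lam_ge0.
  by rewrite eq_sym -val_eqE in ij; rewrite (negbTE ij) mulr0.
have := mean_sqr_ge0 mu (fun x : borel X => f x - g x).
have -> : \int[mu]_x ((f x - g x) ^+ 2) =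
    \int[mu]_x (f x ^+ 2) - 2 * \int[mu]_x (g x * f x) + \int[mu]_x (g x * g x).
  rewrite -meanZ; last exact: bounded_mfunM.
  rewrite -meanB; [|by bmf|by apply: bounded_mfunZ; bmf].
  rewrite -meanD; [|by bmf|by bmf].
  by apply: eq_Rintegral => x _; ring.
rewrite (gh f)// (gh g)//.
under [X in _ + X]eq_bigr do rewrite gpsi -expr2.
under [X in _ - 2 * X]eq_bigr do rewrite -/(a _) -expr2.
by rewrite -/a; lra.
Qed.

(** Bessel for the indicator of {y} bounds the sum of the psi_i(y)^2 by 1/c. Integrating over [y]
    bounds the number of positive eigenvalues by 1/c, and each is at most [lam 0]. *)
Lemma sum_eigenvalues_atomic (c : R) : 0 < c ->
  (forall y : X, c <= fine (mu [set y])) -> (forall y : X, measurable [set (y : borel X)]) ->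
  exists C, forall N, \sum_(i < N) lam i <= C.
Proof.
move=> c0 cmu m1; exists (lam 0%N / c) => N.
have psiN y : \sum_(i < N) psi i y ^+ 2 <= c^-1.
  have := bessel N (bounded_mfun_indic (m1 y)).
  have ind : \int[mu]_x (\1_[set y] x ^+ 2) = fine (mu [set y]) :> R.
    rewrite /Rintegral -[in RHS](setIT [set y]) -integral_indic//.
    congr fine; apply: eq_integral => x _.
    by rewrite indicE; case: (x \in _); rewrite ?expr1n ?expr0n.
  have coef i : \int[mu]_x (\1_[set y] x * psi i x) = psi i y * fine (mu [set y]).
    rewrite -ind -meanZ; last exact/bounded_mfunX/bounded_mfun_indic.
    apply: eq_Rintegral => x _; rewrite indicE; have [|_] := boolP (x \in _).
      by rewrite inE => ->; rewrite expr1n mulr1 mul1r.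
    by rewrite expr0n mulr0 mul0r.
  under eq_bigr do rewrite coef exprMn.
  rewrite -mulr_suml ind.
  have := cmu y; set q := fine _; set s := \sum_(i < N) _ => cq.
  have q0 : 0 < q := lt_le_trans c0 cq.
  rewrite expr2 mulrA -[leRHS]mul1r ler_pM2r// => sq.
  rewrite -[leRHS]mul1r ler_pdivlMr// (le_trans _ sq)// ler_wpM2l//.
  by apply: sumr_ge0 => i _; exact: sqr_ge0.
have card : \sum_(i < N) (0 < lam i)%R%:R <= c^-1 :> R.
  have -> : \sum_(i < N) (0 < lam i)%R%:R = \int[mu]_x (\sum_(i < N) psi i x ^+ 2).
    rewrite mean_sum; last by move=> i; exact: bounded_mfunX.
    apply: eq_bigr => i _; under eq_Rintegral do rewrite expr2.
    have [li|] := ltP 0 (lam i); first by rewrite smooth_eigenfunction_orthonormal// eqxx.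
    move=> li; rewrite -[LHS](@mean_cst _ _ _ mu 0); apply: eq_Rintegral => x _.
    by rewrite smooth_eigenfunction0 ?mul0r//; apply/eqP; rewrite eq_le li lam_ge0.
  by apply: mean_le_cst => //; apply: bounded_mfun_sum => i; exact: bounded_mfunX.
rewrite (le_trans _ (ler_wpM2l (lam_ge0 0%N) card))// mulr_sumr.
apply: ler_sum => i _; have [li|li] := ltP 0 (lam i).
  by rewrite mulr1; case: sys => _ + _ _ _; apply.
by rewrite mulr0.
Qed.

End sum_eigenvalues.

Lemma measurable_set1_borel {R : realType} (X : pmetricType R) (y : X) :
  measurable [set (y : borel X)].
Proof.
rewrite (_ : [set _] = ~` [set x : borel X | - mdist y x < 0]).
  apply/measurableC/measurable_lt_set; apply: measurableT_comp => //.
  exact: measurable_lipschitz (@lipschitz_mdistr _ _ y).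
apply/seteqP; split => [x /= ->|x /= /negP]; first by rewrite mdistxx oppr0 ltxx.
rewrite -leNgt oppr_ge0 => xy; apply/esym/mdist_positivity/eqP.
by rewrite eq_le xy mdist_ge0.
Qed.

(** Every sample point has mass at least 1/(n+1); repetitions only increase it. *)
Lemma sum_eigenvalues_sample {R : realType} (X : pmetricType R) n (x : 'I_n.+1 -> X)
    (lam : nat -> R) (phi : nat -> sample_mm x -> R) : positive_eigensystem lam phi ->
  exists C, forall N, \sum_(i < N) lam i <= C.
Proof.
move=> sys; apply: (@sum_eigenvalues_atomic _ _ _ _ sys n.+1%:R^-1).
- by rewrite invr_gt0.
- move=> y; have [i yi] : exists i, y = sample_point x i.
    case: y => y yx; have [i _ xi] := set_mem yx.
    by exists i; exact: val_inj.
  rewrite -lee_fin fineK; last first.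
    apply: (fin_num_measure (mm_measure (sample_mm x))).
    exact: (@measurable_set1_borel _ (sample_mm x)).
  rewrite /=/sample_measure -[leLHS]mule1 lee_pmul2l// ?lte_fin ?invr_gt0//.
  rewrite (bigD1 i)//= diracE mem_set//.
  by rewrite leeDl// sume_ge0.
- by move=> y; exact: (@measurable_set1_borel _ (sample_mm x)).
Qed.

(** * Convergence of the output kernel *)

Section ae_le_integral.
Import HBNNSimple.

(** As [f] is not assumed measurable, [g] is compared with each simple function below [f] in the
    definition of the integral. *)
Lemma ae_le_integral {R : realType} d (T : measurableType d)
    (mu : {measure set T -> \bar R}) (f g : T -> \bar R) :
  (forall x, 0 <= f x)%E -> (forall x, 0 <= g x)%E -> measurable_fun setT g ->
  {ae mu, forall x, (f x <= g x)%E} -> (\int[mu]_x f x <= \int[mu]_x g x)%E.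
Proof.
move=> f0 g0 mg fg; rewrite ge0_integralTE//; apply: ge_ereal_sup => _ [h hf <-].
have -> : sintegral mu h = (\int[mu]_x (h x)%:E)%E by rewrite integral_nnsfun// patch_setT.
apply: ae_ge0_le_integral => //.
- by move=> x _; rewrite lee_fin.
- exact/measurable_EFinP.
- by apply: filterS fg => x fgx _; exact: le_trans (hf x) fgx.
Qed.

End ae_le_integral.

Lemma ae_preimage {R : realType} d d' (T : measurableType d) (T' : measurableType d')
    (P : {measure set T -> \bar R}) (Q : {measure set T' -> \bar R}) (h : T -> T')
    (A : T' -> Prop) : measurable_fun setT h ->
  (forall B, measurable B -> P (h @^-1` B) = Q B) ->
  {ae Q, forall y, A y} -> {ae P, forall x, A (h x)}.
Proof.
move=> mh PQ [N [mN N0 AN]]; exists (h @^-1` N); split.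
- by rewrite -[X in measurable X]setTI; exact: mh.
- by rewrite -N0; exact: PQ.
- by move=> x /= Ax; exact: AN.
Qed.

Section pointwise_convergence.
Context {R : realType} (X : mmSpace R).
Local Notation mu := (mm_measure X).
Variables (lam : nat -> R) (phi : nat -> X -> R) (C : R).
Hypotheses (sys : positive_eigensystem lam phi)
  (sumC : forall N, \sum_(i < N) lam i <= C).
Local Notation psi := (smooth_eigenfunction lam phi).

Let lam_ge0 i : 0 <= lam i. Proof. by case: sys. Qed.

Let bpsi := bounded_mfun_smooth_eigenfunction sys.

Lemma mean_sqr_smooth_le i : \int[mu]_x (psi i x ^+ 2) <= 1.
Proof.
have [li|li] := ltP 0 (lam i).
  by under eq_Rintegral do rewrite expr2; rewrite smooth_eigenfunction_orthonormal// eqxx.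
rewrite (_ : \int[mu]_x _ = 0)// -[RHS](@mean_cst _ _ _ mu 0).
apply: eq_Rintegral => x _.
by rewrite smooth_eigenfunction0 ?expr0n//; apply/eqP; rewrite eq_le li lam_ge0.
Qed.

(** The integrals of the terms sum to at most [C], so the series is integrable by monotone
    convergence, hence finite almost everywhere. *)
Lemma sum_diagonal_ae :
  {ae mu, forall x : borel X, exists M, forall N, \sum_(i < N) lam i * psi i x ^+ 2 <= M}.
Proof.
pose F (i : nat) (x : borel X) := (lam i * psi i x ^+ 2)%:E.
have bF i : bounded_mfun (fun x : borel X => lam i * psi i x ^+ 2).
  by apply: bounded_mfunZ; exact: bounded_mfunX.
have mF i : measurable_fun setT (F i) by apply/measurable_EFinP; exact: (bF i).1.
have F0 i x : (0 <= F i x)%E by rewrite lee_fin mulr_ge0// sqr_ge0.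
have : mu.-integrable setT (fun x => \sum_(i <oo) F i x)%E.
  apply/integrableP; split; first by apply: ge0_emeasurable_sum => // i x _.
  under eq_integral do rewrite gee0_abs ?nneseries_ge0//.
  rewrite integral_nneseries//.
  apply: (@le_lt_trans _ _ C%:E); last exact: ltry.
  apply: lime_le; first by apply: is_cvg_nneseries => i _ _; exact: integral_ge0.
  apply/nearW => N; rewrite big_mkord.
  under eq_bigr do rewrite integral_bounded//.
  rewrite sumEFin lee_fin (le_trans _ (sumC N))//.
  apply: ler_sum => i _; rewrite meanZ; last exact: bounded_mfunX.
  by rewrite ler_piMr// mean_sqr_smooth_le.
move=> /integrable_ae => /(_ measurableT); apply: filterS => x /(_ I) Fx.
exists (fine (\sum_(i <oo) F i x)%E) => N.
rewrite -lee_fin fineK// -sumEFin -(big_mkord xpredT (F^~ x)).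
by apply: nneseries_lim_ge => i _ _; exact: F0.
Qed.

(** The term at (x, y) is at most the mean of the diagonal terms at [x] and [y]. Convergence thus
    follows from a condition on each point separately, which can be pulled back along each
    projection. *)
Lemma truncated_kernel_ae : exists A : borel X -> Prop,
  {ae mu, forall x : borel X, A x} /\
  forall x y : borel X, A x -> A y ->
    truncated_kernel lam phi N x y @[N --> \oo] -->
      limn (series (fun i => lam i * phi i x * phi i y)).
Proof.
have phipsi : {ae mu, forall x : borel X, forall i, 0 < lam i -> phi i x = psi i x}.
  apply/ae_foralln => i; have [li|li] := ltP 0 (lam i).
    by apply: filterS (smooth_eigenfunction_ae sys li) => x ->.
  by apply/nearW.
pose A (x : borel X) := (exists M, forall N, \sum_(i < N) lam i * psi i x ^+ 2 <= M) /\
  forall i, 0 < lam i -> phi i x = psi i x.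
have aeA : {ae mu, forall x : borel X, A x} by exact: filterS2 sum_diagonal_ae phipsi.
exists A; split => //.
move=> x y [[M xM] xphi] [[M' yM] yphi].
have -> : (fun N => truncated_kernel lam phi N x y) =
    series (fun i => lam i * phi i x * phi i y).
  apply/funext => N; rewrite /series/= /truncated_kernel big_mkord.
  apply: eq_bigr => i _; have [li|li] := ltP 0 (lam i); first by rewrite xphi ?yphi.
  have -> : lam i = 0 by apply/eqP; rewrite eq_le li lam_ge0.
  by rewrite !mul0r.
apply: normed_cvg; apply: nondecreasing_is_cvgn.
  by apply: nondecreasing_series => n _ _; exact: normr_ge0.
exists ((M + M') / 2) => _ [N _ <-].
rewrite -[leLHS]/(\sum_(0 <= i < N) `|lam i * phi i x * phi i y|) big_mkord.
apply: (@le_trans _ _ (\sum_(i < N) (lam i * psi i x ^+ 2 + lam i * psi i y ^+ 2) / 2)).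
  apply: ler_sum => i _; have [li|li] := ltP 0 (lam i); last first.
    have -> : lam i = 0 by apply/eqP; rewrite eq_le li lam_ge0.
    by rewrite !mul0r normr0 addr0 mul0r.
  rewrite xphi// yphi// -mulrDr -mulrA -mulrA normrM gtr0_norm// ler_wpM2l//.
  rewrite normrM -(real_normK (num_real (psi i x))) -(real_normK (num_real (psi i y))).
  by have := sqr_ge0 (`|psi i x| - `|psi i y|); nra.
by rewrite -mulr_suml big_split/= ler_wpM2r//; apply: lerD; [exact: xM|exact: yM].
Qed.

End pointwise_convergence.

(** * Hilbert-Schmidt inner products of truncated and deflated kernels *)

Section truncated_inner_products.
Context {R : realType} {d : measure_display} {Z : measurableType d}.
Variable nu : probability Z R.
Let P2 : probability (Z * Z)%type R := (nu \x nu)%E.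

Lemma inner_rank_one (G : Z * Z -> R) (f : Z -> R) : bounded_mfun G -> bounded_mfun f ->
  inner P2 (fun p => f p.1 * f p.2) G = kernel_form nu G f.
Proof.
move=> bG bf; have b1 : bounded_mfun (fun p : Z * Z => f p.1).
  by apply: bounded_mfun_comp bf; exact: measurable_fst.
have b2 : bounded_mfun (fun p : Z * Z => f p.2).
  by apply: bounded_mfun_comp bf; exact: measurable_snd.
rewrite /inner mean_prod; last by bmf.
apply: eq_Rintegral => z _; rewrite /kernel_op -meanZr.
  by apply: eq_Rintegral => z' _ /=; ring.
by apply: bounded_mfunM => //; exact: bounded_mfun_section1.
Qed.

Section one_space.
Context (X : mmSpace R) (lam : nat -> R) (phi : nat -> X -> R).
Hypothesis sys : positive_eigensystem lam phi.
Variable pi : Z -> X.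
Hypotheses (mpi : measurable_fun setT (pi : Z -> borel X))
  (nupi : forall A : set (borel X), measurable A -> nu (pi @^-1` A) = mm_measure X A).
Local Notation psi := (smooth_eigenfunction lam phi).

Let lam_ge0 i : 0 <= lam i. Proof. by case: sys. Qed.

Let bpsi i : bounded_mfun (fun z => psi i (pi z)).
Proof. exact: bounded_mfun_comp mpi (bounded_mfun_smooth_eigenfunction sys i). Qed.

Lemma bounded_mfun_pullback_truncated N :
  bounded_mfun (pullback_kernel pi (truncated_kernel lam phi N)).
Proof.
have [m [M]] := bounded_mfun_truncated_kernel sys N.
by move=> TM; apply: (bounded_mfun_pullback mpi m) => x y; exact: TM (x, y).
Qed.

Lemma bounded_mfun_pullback_deflated N :
  bounded_mfun (pullback_kernel pi (deflated_kernel lam phi N)).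
Proof.
have [M [L [_ DM _ mD]]] := lipschitz_deflated_kernel sys N.
by apply: (bounded_mfun_pullback mpi mD) => x y; exact: DM.
Qed.

Lemma inner_truncated (G : Z * Z -> R) N : bounded_mfun G ->
  inner P2 (pullback_kernel pi (truncated_kernel lam phi N)) G =
  \sum_(i < N) lam i * kernel_form nu G (fun z => psi i (pi z)).
Proof.
move=> bG; pose F (i : 'I_N) (p : Z * Z) := lam i * ((psi i (pi p.1) * psi i (pi p.2)) * G p).
have b i : bounded_mfun (fun p : Z * Z => psi i (pi p.1) * psi i (pi p.2)).
  apply: bounded_mfunM.
    by apply: bounded_mfun_comp (bpsi i); exact: measurable_fst.
  by apply: bounded_mfun_comp (bpsi i); exact: measurable_snd.
transitivity (\int[P2]_p (\sum_(i < N) F i p)).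
  apply: eq_Rintegral => p _; rewrite /pullback_kernel /truncated_kernel mulr_suml.
  by apply: eq_bigr => i _; rewrite /F; ring.
rewrite mean_sum; last by move=> i; apply: bounded_mfunZ; exact: bounded_mfunM.
apply: eq_bigr => i _; rewrite meanZ; last exact: bounded_mfunM.
by congr (_ * _); rewrite -inner_rank_one.
Qed.

(** The truncation is a sum of rank one kernels on [psi i], and the deflated operator kills each
    [psi i] with [lam i > 0]. This makes the orthogonality exact already at finite [N]. *)
Lemma inner_truncated_deflated N :
  inner P2 (pullback_kernel pi (truncated_kernel lam phi N))
    (pullback_kernel pi (deflated_kernel lam phi N)) = 0.
Proof.
rewrite inner_truncated; last exact: bounded_mfun_pullback_deflated.
rewrite big1// => i _; have [li|li] := ltP 0 (lam i); last first.
  have -> : lam i = 0 by apply/eqP; rewrite eq_le li lam_ge0.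
  by rewrite mul0r.
rewrite /kernel_form (_ : kernel_op _ _ _ = fun=> 0).
  rewrite /inner; under eq_Rintegral do rewrite mul0r.
  by rewrite mean_cst mulr0.
apply/funext => z; rewrite -(mean_deflated_eigenfunction sys (pi z) (ltn_ord i) li).
have [M [L [_ DM _ mD]]] := lipschitz_deflated_kernel sys N.
have bD : bounded_mfun (fun p : (borel X * borel X)%type => deflated_kernel lam phi N p.1 p.2).
  by split => //; exists M => p; exact: DM.
rewrite -(mean_pullback mpi nupi)//.
apply: bounded_mfunM; last exact: bounded_mfun_smooth_eigenfunction.
exact: (bounded_mfun_section1 (pi z : borel X) bD).
Qed.

Lemma mean_sqr_pullback_smooth_le i : inner nu (fun z => psi i (pi z)) (fun z => psi i (pi z)) <= 1.
Proof.
rewrite (le_trans _ (mean_sqr_smooth_le sys i))// -(mean_pullback mpi nupi); last first.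
  by apply: bounded_mfunX; exact: bounded_mfun_smooth_eigenfunction.
by rewrite le_eqVlt; apply/orP; left; apply/eqP; apply: eq_Rintegral => z _; rewrite expr2.
Qed.

End one_space.

Section two_spaces.
Context (X Y : mmSpace R) (lam kap : nat -> R) (phi : nat -> X -> R) (chi : nat -> Y -> R).
Hypotheses (sysX : positive_eigensystem lam phi) (sysY : positive_eigensystem kap chi).
Variables (pX : Z -> X) (pY : Z -> Y).
Hypotheses (mpX : measurable_fun setT (pX : Z -> borel X))
  (nuX : forall A : set (borel X), measurable A -> nu (pX @^-1` A) = mm_measure X A)
  (mpY : measurable_fun setT (pY : Z -> borel Y))
  (nuY : forall A : set (borel Y), measurable A -> nu (pY @^-1` A) = mm_measure Y A).

(** A rank one kernel on a function of norm at most 1 pairs with the deflated kernel to at most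
    [kap N]; this is the price of stopping at [N]. *)
Lemma inner_truncated_deflated_le N :
  inner P2 (pullback_kernel pX (truncated_kernel lam phi N))
    (pullback_kernel pY (deflated_kernel kap chi N)) <= kap N * \sum_(i < N) lam i.
Proof.
have lam0 i : 0 <= lam i by case: sysX.
have kap0 i : 0 <= kap i by case: sysY.
rewrite (inner_truncated sysX mpX); last exact: bounded_mfun_pullback_deflated.
rewrite mulr_sumr; apply: ler_sum => i _; rewrite mulrC ler_wpM2r//.
have b := bounded_mfun_comp mpX (bounded_mfun_smooth_eigenfunction sysX i).
rewrite (le_trans (deflated_kernel_form_le sysY mpY nuY N b))//.
by rewrite ler_piMr// (mean_sqr_pullback_smooth_le sysX mpX nuX).
Qed.

End two_spaces.

End truncated_inner_products.

(** * Contraction of positive parts *)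

(* Fatou's lemma, for a limit function that need not be measurable. *)
Lemma ae_fatou {R : realType} d (T : measurableType d) (mu : {measure set T -> \bar R})
    (F : nat -> T -> \bar R) (f : T -> \bar R) (b : nat -> \bar R) (l : \bar R) :
  (forall n, measurable_fun setT (F n)) -> (forall n x, 0 <= F n x)%E ->
  (forall x, 0 <= f x)%E -> {ae mu, forall x, F n x @[n --> \oo] --> f x} ->
  (forall n, \int[mu]_x F n x <= b n)%E -> b n @[n --> \oo] --> l ->
  (\int[mu]_x f x <= l)%E.
Proof.
move=> mF F0 f0 Ff Fb bl.
apply: (@le_trans _ _ (\int[mu]_x limn_einf (F^~ x))%E).
  apply: ae_le_integral => //.
  - move=> x; rewrite limn_einf_lim; apply: lime_ge; first exact: is_cvg_einfs.
    by apply/nearW => n; apply: le_ereal_inf_tmp => _ [k _ <-].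
  - rewrite /limn_einf; apply: measurableT_comp => //.
    by apply: measurable_fun_limn_esup => n; exact: measurableT_comp.
  - by apply: filterS Ff => x Fx; have [-> _] := cvg_limn_einf_sup Fx.
apply: (le_trans (fatou mu measurableT mF (fun n x _ => F0 n x))).
rewrite limn_einf_lim -(cvg_lim _ bl)//; apply: lee_lim.
- exact: is_cvg_einfs.
- by apply/cvg_ex; exists l.
- apply/nearW => n; apply: le_trans (Fb n).
  by apply: ereal_inf_lbound; exists n => /=.
Qed.

Section contraction.
Context {R : realType} {d : measure_display} {Z : measurableType d}.
Variable nu : probability Z R.
Let P2 : probability (Z * Z)%type R := (nu \x nu)%E.
Context (X Y : mmSpace R) (lam kap : nat -> R) (phi : nat -> X -> R) (chi : nat -> Y -> R).
Variables (CX CY : R).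
Hypotheses (sysX : positive_eigensystem lam phi) (sysY : positive_eigensystem kap chi)
  (sumX : forall N, \sum_(i < N) lam i <= CX) (sumY : forall N, \sum_(i < N) kap i <= CY).
Variables (pX : Z -> X) (pY : Z -> Y).
Hypotheses (mpX : measurable_fun setT (pX : Z -> borel X))
  (nuX : forall A : set (borel X), measurable A -> nu (pX @^-1` A) = mm_measure X A)
  (mpY : measurable_fun setT (pY : Z -> borel Y))
  (nuY : forall A : set (borel Y), measurable A -> nu (pY @^-1` A) = mm_measure Y A).

Definition kernel_difference (p : Z * Z) : R :=
  pullback_kernel pX (cMDS_kernel (X := X)) p - pullback_kernel pY (cMDS_kernel (X := Y)) p.

Definition truncated_difference N (p : Z * Z) : R :=
  pullback_kernel pX (truncated_kernel lam phi N) p -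
  pullback_kernel pY (truncated_kernel kap chi N) p.

Lemma bounded_mfun_pullback_cMDS (V : mmSpace R) (q : Z -> V) :
  measurable_fun setT (q : Z -> borel V) ->
  bounded_mfun (pullback_kernel q (cMDS_kernel (X := V))).
Proof.
move=> mq; have [M [L [_ [_ KM _ mK]]]] := lipschitz_cMDS_kernel V.
by apply: (bounded_mfun_pullback mq mK) => x y; exact: KM.
Qed.

Lemma bounded_mfun_truncated_difference N : bounded_mfun (truncated_difference N).
Proof.
apply: bounded_mfunB; first exact: bounded_mfun_pullback_truncated.
exact: bounded_mfun_pullback_truncated.
Qed.

(* Writing [A - B = (A+ - B+) - (A- - B-)] with positive and negative parts, the cross
   term [<A+ - B+, A- - B->] is nonpositive because [<A+, A->] and [<B+, B->] vanish. *)
Lemma truncated_difference_le N :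
  inner P2 (truncated_difference N) (truncated_difference N) <=
  inner P2 kernel_difference kernel_difference
    + 2 * (kap N * \sum_(i < N) lam i + lam N * \sum_(i < N) kap i).
Proof.
have bA := bounded_mfun_pullback_truncated sysX mpX N.
have bB := bounded_mfun_pullback_truncated sysY mpY N.
have bA' := bounded_mfun_pullback_deflated sysX mpX N.
have bB' := bounded_mfun_pullback_deflated sysY mpY N.
have AA' := inner_truncated_deflated sysX mpX nuX N.
have BB' := inner_truncated_deflated sysY mpY nuY N.
have AB' := inner_truncated_deflated_le sysX sysY mpX nuX mpY nuY N.
have BA' := inner_truncated_deflated_le sysY sysX mpY nuY mpX nuX N.
move: AA' BB' AB' BA'; rewrite -/P2.
rewrite /truncated_difference.
have -> : kernel_difference = fun p =>
    (pullback_kernel pX (truncated_kernel lam phi N) p -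
     pullback_kernel pY (truncated_kernel kap chi N) p) +
    (pullback_kernel pX (deflated_kernel lam phi N) p -
     pullback_kernel pY (deflated_kernel kap chi N) p).
  apply/funext => p; rewrite /kernel_difference /pullback_kernel /deflated_kernel; ring.
set A := pullback_kernel pX _; set B := pullback_kernel pY _.
(* [A'] and [B'] play the part of minus the negative parts, so the cross term to be bounded from
   below is <A - B, A' - B'>. *)
set A' := pullback_kernel pX _; set B' := pullback_kernel pY _ => AA' BB' AB' BA'.
have innerB f g h : bounded_mfun f -> bounded_mfun g -> bounded_mfun h ->
    inner P2 (fun p => f p - g p) h = inner P2 f h - inner P2 g h.
  move=> bf bg bh; rewrite /inner -meanB; [|by bmf..].
  by apply: eq_Rintegral => p _; rewrite mulrBl.
have innerBr f g h : bounded_mfun f -> bounded_mfun g -> bounded_mfun h ->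
    inner P2 h (fun p => f p - g p) = inner P2 h f - inner P2 h g.
  by move=> bf bg bh; rewrite innerC innerB// !(innerC _ h).
have := inner_ge0 P2 (fun p => A' p - B' p).
have sqrD f g : bounded_mfun f -> bounded_mfun g ->
    inner P2 (fun p => f p + g p) (fun p => f p + g p) =
    inner P2 f f + 2 * inner P2 f g + inner P2 g g.
  move=> bf bg; rewrite innerDl; [|by bmf..]; rewrite !innerDr; [|by bmf..].
  by rewrite (innerC _ g f); ring.
rewrite (sqrD (fun p => A p - B p) (fun p => A' p - B' p)); [|by bmf..].
have -> : inner P2 (fun p => A p - B p) (fun p => A' p - B' p) =
    - inner P2 A B' - inner P2 B A'.
  rewrite innerB; [|by bmf..]; rewrite (innerBr A' B' A) ?(innerBr A' B' B)//.
  by rewrite AA' BB'; ring.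
lra.
Qed.

Lemma eigenvalue_le (mu : nat -> R) C N : (forall i, 0 <= mu i) ->
  (forall i j, (i <= j)%N -> mu j <= mu i) ->
  (forall N, \sum_(i < N) mu i <= C) -> mu N <= C / N.+1%:R.
Proof.
move=> mu0 mui sC; rewrite ler_pdivlMr//; apply: le_trans (sC N.+1).
have -> : mu N * N.+1%:R = \sum_(i < N.+1) mu N by rewrite sumr_const card_ord mulr_natr.
by apply: ler_sum => i _; apply: mui; rewrite -ltnS.
Qed.

(** The first N+1 eigenvalues are at least the one of index [N], which is therefore at most the sum
    bound over N+1. Both error products are then at most CX CY / (N+1), and each enters with factor
    2. *)
Lemma truncated_difference_le_harmonic N :
  inner P2 (truncated_difference N) (truncated_difference N) <=
  inner P2 kernel_difference kernel_difference + 4 * CX * CY * N.+1%:R^-1.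
Proof.
have [lam0 lamd _ _ _] := sysX; have [kap0 kapd _ _ _] := sysY.
apply: (le_trans (truncated_difference_le N)); rewrite lerD2l.
have CX0 : 0 <= CX by rewrite (le_trans _ (sumX 0%N))// big_ord0.
have CY0 : 0 <= CY by rewrite (le_trans _ (sumY 0%N))// big_ord0.
have : kap N * \sum_(i < N) lam i <= CY / N.+1%:R * CX.
  by rewrite ler_pM ?sumr_ge0//; exact: eigenvalue_le.
have : lam N * \sum_(i < N) kap i <= CX / N.+1%:R * CY.
  by rewrite ler_pM ?sumr_ge0//; exact: eigenvalue_le.
by move: (N.+1%:R^-1) => t; lra.
Qed.

(** Fatou along the truncations, which converge at every pair whose four projections to [X] and [Y]
    avoid the exceptional null sets. *)
Lemma output_kernel_distance_le (K : X -> X -> R) (L : Y -> Y -> R) :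
  (forall x x', K x x' = limn (series (fun i => lam i * phi i x * phi i x'))) ->
  (forall y y', L y y' = limn (series (fun i => kap i * chi i y * chi i y'))) ->
  (\int[P2]_p ((pullback_kernel pX K p - pullback_kernel pY L p) ^+ 2)%:E <=
    (inner P2 kernel_difference kernel_difference)%:E)%E.
Proof.
move=> KE LE; set S := inner _ _ _.
have [AX [aeX cvX]] := truncated_kernel_ae sysX sumX.
have [AY [aeY cvY]] := truncated_kernel_ae sysY sumY.
have P2fst (B : set Z) : measurable B -> P2 (fst @^-1` B) = nu B.
  move=> mB; rewrite (_ : fst @^-1` B = B `*` setT).
    have := product_measure1E nu nu mB (@measurableT _ Z).
    by rewrite [X in (_ * X)%E](probability_setT nu) mule1.
  by apply/seteqP; split => -[x y] //= [].
have P2snd (B : set Z) : measurable B -> P2 (snd @^-1` B) = nu B.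
  move=> mB; rewrite (_ : snd @^-1` B = setT `*` B).
    have := product_measure1E nu nu (@measurableT _ Z) mB.
    by rewrite [X in (X * _)%E](probability_setT nu) mul1e.
  by apply/seteqP; split => -[x y] //= [].
have aeXz := ae_preimage mpX nuX aeX; have aeYz := ae_preimage mpY nuY aeY.
have aeX1 := ae_preimage measurable_fst P2fst aeXz.
have aeX2 := ae_preimage measurable_snd P2snd aeXz.
have aeY1 := ae_preimage measurable_fst P2fst aeYz.
have aeY2 := ae_preimage measurable_snd P2snd aeYz.
apply: (@ae_fatou _ _ _ P2 (fun N p => (truncated_difference N p ^+ 2)%:E) _
  (fun N => (S + 4 * CX * CY * N.+1%:R^-1)%:E)).
- move=> N; apply/measurable_EFinP.
  exact: (bounded_mfunX 2 (bounded_mfun_truncated_difference N)).1.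
- by move=> N p; rewrite lee_fin sqr_ge0.
- by move=> p; rewrite lee_fin sqr_ge0.
- apply: filterS2 (filterI aeX1 aeX2) (filterI aeY1 aeY2) => p [X1 X2] [Y1 Y2].
  apply: cvg_EFin; first exact: nearW.
  have c : truncated_difference N p @[N --> \oo] -->
      pullback_kernel pX K p - pullback_kernel pY L p.
    apply: cvgB; first by rewrite /pullback_kernel KE; exact: cvX.
    by rewrite /pullback_kernel LE; exact: cvY.
  exact: (cvgM c c).
- move=> N; have bT := bounded_mfun_truncated_difference N.
  rewrite integral_bounded; last exact: bounded_mfunX.
  rewrite lee_fin; apply: le_trans (truncated_difference_le_harmonic N).
  by rewrite le_eqVlt; apply/orP; left; apply/eqP; apply: eq_Rintegral => p _; rewrite expr2.
- apply: cvg_EFin; first exact: nearW.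
  rewrite -[X in _ --> X]addr0; apply: cvgD; first exact: cvg_cst.
  rewrite -[X in _ --> X](mulr0 (4 * CX * CY)); apply: cvgM; first exact: cvg_cst.
  exact: cvg_harmonic.
Qed.

End contraction.

(** * Transport cost and kernel distance *)

Lemma measurable_isometry {R : realType} (X Y : pmetricType R) (s : Y -> X) :
  (forall y y', mdist (s y) (s y') = mdist y y') ->
  measurable_fun setT (s : borel Y -> borel X).
Proof.
move=> ss; have := @measurability _ _ (borel Y) (borel X) setT s (@open X) erefl; apply.
move=> _ [U oU <-]; rewrite setTI; apply: sub_sigma_algebra.
suff : open (s @^-1` U : set Y) by [].
rewrite openE => y /= Uy; move: oU; rewrite openE => /(_ _ Uy)/nbhs_ballP[r r0 rU].
apply/nbhs_ballP; exists r => // y'; rewrite ballEmdist/= -ss => yy'.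
by apply: rU; rewrite ballEmdist.
Qed.

Section coupling_distance.
Context {R : realType} (X Y : mmSpace R) (s : Y -> X).
Hypothesis ss : forall y y', mdist (s y) (s y') = mdist y y'.
Variable g : probability (borel X * borel Y)%type R.
Hypothesis cg : is_coupling g.
Local Notation Z := (borel X * borel Y)%type.

Definition coupling_cost : R := \int[g]_z mdist (z.1 : X) (s z.2).

Let delta (z : Z) : R := mdist (z.1 : X) (s z.2).

Lemma bounded_mfun_cost : bounded_mfun delta.
Proof.
have mh : measurable_fun setT (fun z : Z => (z.1, s z.2 : borel X)).
  apply: measurable_fun_pair; first exact: measurable_fst.
  exact: measurableT_comp (measurable_isometry ss) measurable_snd.
exact: bounded_mfun_comp mh (bounded_mfun_mdist X).
Qed.

Lemma coupling_fst A : measurable A -> g (fst @^-1` A) = mm_measure X A.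
Proof.
move=> mA; case: cg => + _ => /(_ A mA) <-; congr (g _).
by apply/seteqP; split => -[x y] //= [].
Qed.

Lemma coupling_snd B : measurable B -> g (snd @^-1` B) = mm_measure Y B.
Proof.
move=> mB; case: cg => _ /(_ B mB) <-; congr (g _).
by apply/seteqP; split => -[x y] //= [].
Qed.

(** Comparing the kernels term by term bounds the difference by D t with t = 2 delta(p.1) + 2
    delta(p.2) + 4 W. Since t <= 8 D, its square is at most 8 D^3 t, and [t] has mean 8 W. *)
Lemma kernel_difference_le D : 0 < D -> (forall x y : X, mdist x y <= D) ->
  inner (g \x g)%E (kernel_difference (fst : Z -> X) (snd : Z -> Y))
    (kernel_difference (fst : Z -> X) (snd : Z -> Y)) <= 64 * D ^+ 3 * coupling_cost.
Proof.
move=> D0 DX; set W := coupling_cost.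
have bd := bounded_mfun_cost.
have d0 z : 0 <= delta z by exact: mdist_ge0.
have dD z : delta z <= D by exact: DX.
have d2X := bounded_mfunX 2 (bounded_mfun_mdist X).
have d2Y := bounded_mfunX 2 (bounded_mfun_mdist Y).
have bX x : bounded_mfun (fun v : borel X => mdist (x : X) (v : X) ^+ 2) :=
  bounded_mfun_section1 (x : borel X) d2X.
have bY y : bounded_mfun (fun v : borel Y => mdist (y : Y) (v : Y) ^+ 2) :=
  bounded_mfun_section1 (y : borel Y) d2Y.
have d2le (z z' : Z) :
    `|mdist (z.1 : X) (z'.1 : X) ^+ 2 - mdist (z.2 : Y) (z'.2 : Y) ^+ 2| <=
    2 * D * (delta z + delta z').
  by rewrite -ss; exact: sqr_mdist_le.
pose a x := \int[mm_measure X]_v mdist x (v : X) ^+ 2.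
pose b y := \int[mm_measure Y]_v mdist y (v : Y) ^+ 2.
have ba : bounded_mfun (a : borel X -> R) := bounded_mfun_mean (mm_measure X) (mm_measure X) d2X.
have bb : bounded_mfun (b : borel Y -> R) := bounded_mfun_mean (mm_measure Y) (mm_measure Y) d2Y.
have able (z : Z) : `|a z.1 - b z.2| <= 2 * D * (delta z + W).
  rewrite /a /b -(mean_pushforward measurable_fst coupling_fst (bX z.1)).
  rewrite -(mean_pushforward measurable_snd coupling_snd (bY z.2)).
  have b1 := bounded_mfun_comp (@measurable_fst _ _ (borel X) (borel Y)) (bX z.1).
  have b2 := bounded_mfun_comp (@measurable_snd _ _ (borel X) (borel Y)) (bY z.2).
  rewrite -meanB//; apply: (le_trans (mean_norm_le _ (bounded_mfunB b1 b2))).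
  have bz : bounded_mfun (fun z' : Z => delta z + delta z').
    by apply: bounded_mfunD => //; exact: bounded_mfun_cst.
  rewrite -(mean_cst g (delta z)) /W /coupling_cost -meanD//; last exact: bounded_mfun_cst.
  rewrite -meanZ//; apply: mean_le.
  - by apply: bounded_mfun_norm; exact: bounded_mfunB.
  - exact: bounded_mfunZ.
  - by move=> z'; exact: d2le.
have cle : `|\int[mm_measure X]_x a x - \int[mm_measure Y]_y b y| <= 4 * D * W.
  rewrite -(mean_pushforward measurable_fst coupling_fst ba).
  rewrite -(mean_pushforward measurable_snd coupling_snd bb).
  have b1 := bounded_mfun_comp (@measurable_fst _ _ (borel X) (borel Y)) ba.
  have b2 := bounded_mfun_comp (@measurable_snd _ _ (borel X) (borel Y)) bb.
  rewrite -meanB//; apply: (le_trans (mean_norm_le _ (bounded_mfunB b1 b2))).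
  have bz : bounded_mfun (fun z' : Z => delta z' + W).
    by apply: bounded_mfunD => //; exact: bounded_mfun_cst.
  apply: (@le_trans _ _ (\int[g]_z (2 * D * (delta z + W)))).
    apply: mean_le => //; [|exact: bounded_mfunZ].
    by apply: bounded_mfun_norm; exact: bounded_mfunB.
  rewrite meanZ// meanD//; last exact: bounded_mfun_cst.
  rewrite mean_cst -/(coupling_cost) -/W; lra.
have W0 : 0 <= W by apply: Rintegral_ge0 => z _; exact: d0.
have WD : W <= D by apply: mean_le_cst.
set F := kernel_difference _ _.
have bF : bounded_mfun F.
  by apply: bounded_mfunB; apply: bounded_mfun_pullback_cMDS.
have Fle p : `|F p| <= D * (2 * delta p.1 + 2 * delta p.2 + 4 * W).
  have := d2le p.1 p.2; have := able p.1; have := able p.2; move: cle.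
  rewrite /F /kernel_difference /pullback_kernel /cMDS_kernel !mean_sqr_mdistC.
  rewrite -/(a _) -/(a _) -/(b _) -/(b _) !ler_norml.
  by move=> /andP[? ?] /andP[? ?] /andP[? ?] /andP[? ?]; apply/andP; split; lra.
have b1 : bounded_mfun (fun p : Z * Z => delta p.1).
  by apply: bounded_mfun_comp bd; exact: measurable_fst.
have b2 : bounded_mfun (fun p : Z * Z => delta p.2).
  by apply: bounded_mfun_comp bd; exact: measurable_snd.
have bs : bounded_mfun (fun p : Z * Z => 2 * delta p.1 + 2 * delta p.2 + 4 * W).
  by apply: bounded_mfunD; [apply: bounded_mfunD; exact: bounded_mfunZ|exact: bounded_mfun_cst].
apply: (@le_trans _ _ (\int[(g \x g)%E]_p (8 * D ^+ 3 * (2 * delta p.1 + 2 * delta p.2 + 4 * W)))).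
  apply: mean_le; [exact: bounded_mfunM|exact: bounded_mfunZ|] => p.
  have t0 : 0 <= 2 * delta p.1 + 2 * delta p.2 + 4 * W.
    by have := d0 p.1; have := d0 p.2; lra.
  have tD : 2 * delta p.1 + 2 * delta p.2 + 4 * W <= 8 * D.
    by have := dD p.1; have := dD p.2; lra.
  rewrite -expr2 -(real_normK (num_real (F p))).
  apply: (@le_trans _ _ ((D * (2 * delta p.1 + 2 * delta p.2 + 4 * W)) ^+ 2)).
    by rewrite ler_sqr ?nnegrE// mulr_ge0// ltW.
  move: t0 tD; set t := (2 * delta p.1 + _ + _) => t0 tD.
  have -> : (D * t) ^+ 2 = D ^+ 2 * t * t by ring.
  have -> : 8 * D ^+ 3 * t = D ^+ 2 * t * (8 * D) by ring.
  by rewrite ler_wpM2l// mulr_ge0// sqr_ge0.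
have e1 : \int[(g \x g)%E]_p delta p.1 = W.
  rewrite mean_prod//; apply: eq_Rintegral => z _; by rewrite /= mean_cst.
have e2 : \int[(g \x g)%E]_p delta p.2 = W.
  by rewrite mean_prod//= mean_cst.
rewrite meanZ// meanD; [|by apply: bounded_mfunD; exact: bounded_mfunZ|exact: bounded_mfun_cst].
rewrite meanD; [|exact: bounded_mfunZ..].
rewrite (meanZ _ 2 b1) (meanZ _ 2 b2) e1 e2 mean_cst; lra.
Qed.

Lemma coupling_L2_distance_le D (K : X -> X -> R) (L : Y -> Y -> R)
    (lam kap : nat -> R) (phi : nat -> X -> R) (chi : nat -> Y -> R) (CX CY : R) :
  0 < D -> (forall x y : X, mdist x y <= D) ->
  positive_eigensystem lam phi -> positive_eigensystem kap chi ->
  (forall N, \sum_(i < N) lam i <= CX) -> (forall N, \sum_(i < N) kap i <= CY) ->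
  (forall x x', K x x' = limn (series (fun i => lam i * phi i x * phi i x'))) ->
  (forall y y', L y y' = limn (series (fun i => kap i * chi i y * chi i y'))) ->
  (coupling_L2_distance g K L <= ((64 * D ^+ 3 * coupling_cost)%:E `^ 2^-1))%E.
Proof.
move=> D0 DX sX sY cX cY KE LE; rewrite /coupling_L2_distance unlock.
apply: gt0_ler_poweR => //.
- rewrite in_itv/= leey andbT; apply: integral_ge0 => p _; by rewrite /= lee_fin powR_ge0.
- rewrite in_itv/= leey andbT lee_fin mulr_ge0//.
    by rewrite mulr_ge0// exprn_ge0// ltW.
  by apply: Rintegral_ge0 => z _; exact: mdist_ge0.
have := kernel_difference_le D0 DX; rewrite -lee_fin; apply: le_trans.
have := output_kernel_distance_le sX sY cX cY measurable_fst coupling_fst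
  measurable_snd coupling_snd KE LE; apply: le_trans.
rewrite le_eqVlt; apply/orP; left; apply/eqP; apply: eq_integral => p _.
by rewrite /= powR_mulrn// real_normK// num_real.
Qed.

End coupling_distance.

(** * Couplings with an empirical measure *)

(** Packages the pushforward with its measure structure, which depends on [mh]; it is transparent so
    that its values compute to measures of preimages. *)
Definition image_measure {R : realType} d1 d2 (T1 : measurableType d1)
    (T2 : measurableType d2) (m : {measure set T1 -> \bar R}) (h : T1 -> T2)
    (mh : measurable_fun setT h) : {measure set T2 -> \bar R}.
Proof. refine (pushforward m h : {measure set T2 -> \bar R}); exact: mh. Defined.

(** Normalising a measure of mass 1 changes nothing but yields a probability; the Dirac mass is only
    the default of [mnormalize]. *)
Lemma exists_mixture {R : realType} d1 d2 (T1 : measurableType d1)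
    (T2 : measurableType d2) n (m : nat -> {measure set T1 -> \bar R})
    (h : nat -> T1 -> T2) : (forall i, measurable_fun setT (h i)) ->
  (\sum_(i < n) m i setT = 1)%E ->
  exists g : probability T2 R, forall E, g E = (\sum_(i < n) m i (h i @^-1` E))%E.
Proof.
move=> mh m1; have nE (im : {measure set T2 -> \bar R}) (P : probability T2 R) :
    im setT = 1%E -> forall E, mnormalize im P E = im E.
  by move=> im1 E; rewrite /mnormalize im1 onee_eq0/= invr1 mule1.
exists (mnormalize (msum (fun i => image_measure (m i) (mh i)) n) (dirac point)).
by apply: nE; exact: m1.
Qed.

Section exists_coupling.
Context {R : realType} (X : mmSpace R) (n : nat) (x : 'I_n.+1 -> X).
Local Notation mu := (mm_measure X).
Local Notation Y := (sample_mm x).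
Variables (J : X -> nat) (m : nat) (e eta D : R).
Hypotheses (mJ : forall j, measurable (J @^-1` [set j] : set (borel X)))
  (Jm : forall a, (J a < m)%N) (Je : forall a b, J a = J b -> mdist a b <= e)
  (e0 : 0 <= e) (DX : forall a b : X, mdist a b <= D) (eta1 : eta <= 1).

Definition cell j : set (borel X) := J @^-1` [set j].

Definition frequency j : R := n.+1%:R^-1 * \sum_(i < n.+1) (J (x i) == j)%:R.

Hypothesis freq : forall j, (1 - eta) * fine (mu (cell j)) <= frequency j.

Let r (C : set (borel X)) := fine (mu C).

Let muE C : measurable C -> mu C = (r C)%:E.
Proof. by move=> mC; rewrite fineK//; exact: fin_num_measure. Qed.

Let r_ge0 C : 0 <= r C. Proof. exact/fine_ge0/measure_ge0. Qed.

Let mcell j : measurable (cell j). Proof. exact: mJ. Qed.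

Let sum_cells C : measurable C -> \sum_(j < m) r (C `&` cell j) = r C.
Proof.
move=> mC; apply: EFin_inj; rewrite -sumEFin -muE//.
rewrite (eq_bigr (fun j : 'I_m => mu (C `&` cell j))); last first.
  by move=> j _; rewrite muE//; exact: measurableI.
rewrite -measure_bigsetU_ord//.
- congr (mu _); apply/seteqP; split => [a|a Ca].
    by rewrite -(bigcup_mkord m (fun j => C `&` cell j)) => -[j _ []].
  by rewrite -(bigcup_mkord m (fun j => C `&` cell j)); exists (J a) => //=; exact: Jm.
- by move=> j; exact: measurableI.
- by move=> i j _ _ [a [[_ ai] [_ aj]]]; apply/val_inj; move: ai aj; rewrite /cell/= => <- <-.
Qed.

Let inv_n0 : 0 <= n.+1%:R^-1 :> R. Proof. by rewrite invr_ge0. Qed.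

Let freq_gt0 i : 0 < frequency (J (x i)).
Proof.
rewrite /frequency mulr_gt0 ?invr_gt0//.
by rewrite (bigD1 i)//= eqxx ltr_wpDr// sumr_ge0.
Qed.

(** The coupling sends to sample point [i] the measure with mass 1/(n+1) formed by [cc i] times [mu]
    restricted to its cell plus [bb i] times [mu]. Over the points of one cell the restricted parts
    add up to (1 - eta) [mu] on that cell, and the remaining parts add up to eta [mu]; [freq] is
    what makes [bb i] nonnegative. *)
Let cc i := (1 - eta) / frequency (J (x i)).

Let bb i := 1 - cc i * r (cell (J (x i))).

Let cc_ge0 i : 0 <= cc i.
Proof. by rewrite divr_ge0 ?subr_ge0// ltW// freq_gt0. Qed.

Let bb_ge0 i : 0 <= bb i.
Proof. by rewrite subr_ge0 mulrAC ler_pdivrMr// mul1r; exact: freq. Qed.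

Let sum_cc C : measurable C ->
  \sum_(i < n.+1) n.+1%:R^-1 * (cc i * r (C `&` cell (J (x i)))) = (1 - eta) * r C.
Proof.
move=> mC.
transitivity (\sum_(i < n.+1) \sum_(j < m) (J (x i) == j)%:R *
    (n.+1%:R^-1 * ((1 - eta) / frequency j * r (C `&` cell j)))).
  apply: eq_bigr => i _; rewrite (bigD1 (Ordinal (Jm (x i))))//= eqxx mul1r.
  rewrite big1 ?addr0// => j; rewrite -val_eqE/= eq_sym => /negbTE ->.
  by rewrite mul0r.
rewrite exchange_big/= -sum_cells// mulr_sumr; apply: eq_bigr => j _.
rewrite -mulr_suml mulrA (mulrC _ n.+1%:R^-1) -/(frequency j).
(* In a cell without sample points the left side is 0, and [freq] forces (1 - eta) mu(cell) = 0. *)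
have [q0|q0] := eqVneq (frequency j) 0; last by rewrite mulrA mulrCA divff// mulr1.
rewrite q0 mul0r; apply/esym/eqP; rewrite eq_le mulr_ge0 ?subr_ge0// andbT.
rewrite -q0 (le_trans _ (freq j))// ler_wpM2l ?subr_ge0// fine_le//.
- by apply: fin_num_measure; exact: measurableI.
- exact: fin_num_measure.
- by apply: le_measure => //; rewrite inE//; exact: measurableI.
Qed.

Let sum_bb : \sum_(i < n.+1) n.+1%:R^-1 * bb i = eta.
Proof.
have r1 : r setT = 1 by rewrite /r [X in fine X](probability_setT mu).
have := sum_cc measurableT; rewrite r1 mulr1.
under eq_bigr do rewrite setTI.
move=> cE; under eq_bigr do rewrite mulrBr mulr1.
rewrite big_split/= sumrN cE sumr_const card_ord -[_ *+ _]mulr_natr mulVf ?pnatr_eq0//.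
by rewrite opprB addrC subrK.
Qed.

Let mm (i : nat) : {measure set (borel X) -> \bar R} :=
  mscale (NngNum inv_n0) (measure_add
    (mscale (NngNum (cc_ge0 (inord i))) (mrestr mu (mJ (J (x (inord i))))))
    (mscale (NngNum (bb_ge0 (inord i))) mu)).

Let mmE (i : 'I_n.+1) C : measurable C -> mm i C =
  (n.+1%:R^-1 * (cc i * r (C `&` cell (J (x i))) + bb i * r C))%:E.
Proof.
move=> mC; have -> : mm i C = ((n.+1%:R^-1)%:E * ((cc (inord i))%:E *
    mu (C `&` cell (J (x (inord i)))) + (bb (inord i))%:E * mu C))%E.
  by congr (_ * _)%E; exact: measure_addE.
rewrite inord_val.
by rewrite !muE//; exact: measurableI.
Qed.

Let sum_mm C : measurable C -> (\sum_(i < n.+1) mm i C = mu C)%E.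
Proof.
move=> mC; under eq_bigr do rewrite mmE//.
rewrite sumEFin muE//; congr EFin.
under eq_bigr do rewrite mulrDr mulrA.
rewrite big_split/=; under eq_bigr do rewrite -mulrA.
rewrite sum_cc//; under eq_bigr do rewrite mulrA.
by rewrite -mulr_suml sum_bb -mulrDl subrK mul1r.
Qed.

Let hh (i : nat) (a : borel X) : (borel X * borel Y)%type :=
  (a, sample_point x (inord i) : borel Y).

Let mhh i : measurable_fun setT (hh i).
Proof. by apply: measurable_fun_pair => //; exact: measurable_id. Qed.

Let sval_iso (a b : Y) : mdist (sval a : X) (sval b) = mdist a b. Proof. by []. Qed.

Lemma exists_coupling : exists g : probability (borel X * borel Y)%type R,
  is_coupling g /\ coupling_cost (fun y : Y => sval y) g <= e + eta * D.
Proof.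
have [g gE] : exists g : probability (borel X * borel Y)%type R,
    forall E, g E = (\sum_(i < n.+1) mm i (hh i @^-1` E))%E.
  by apply: exists_mixture mhh _; rewrite sum_mm// probability_setT.
have cg : is_coupling g.
  split => [A mA|B mB].
    rewrite gE -sum_mm//; apply: eq_bigr => i _; congr (mm i _).
    by apply/seteqP; split => [a []//|a Aa].
  rewrite gE [RHS]/= /sample_measure ge0_sume_distrr//.
  apply: eq_bigr => i _; rewrite diracE.
  rewrite [in LHS](_ : hh i @^-1` _ = if sample_point x i \in B then setT else set0).
    case: (_ \in B); last by rewrite measure0 mule0.
    rewrite mmE// setTI mule1; congr EFin.
    rewrite /bb [r setT](_ : _ = 1) ?mulr1; last by rewrite /r [X in fine X](probability_setT mu).
    by rewrite addrC subrK mulr1.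
  apply/seteqP; split => [a [_]|a]; rewrite /hh/= inord_val.
    by move=> Bx; rewrite mem_set.
  by case: ifPn => //; rewrite inE.
exists g; split => //.
pose U : set (borel X * borel Y)%type := [set z | J z.1 = J (sval z.2)].
have mU : measurable U.
  rewrite (_ : U = \bigcup_j (cell j `*` ((sval : Y -> X) @^-1` cell j))).
    apply: bigcupT_measurable => j; apply: measurableX; first exact: mJ.
    rewrite -[X in measurable X]setTI.
    exact: (measurable_isometry sval_iso).
  apply/seteqP; split => [z Uz|z [j _ [/= zj1 zj2]]].
    by exists (J z.1) => //; split => //=; exact: esym.
  by rewrite /U/= zj1 zj2.
have bU := bounded_mfun_indic (R := R) (measurableC mU).
(* The restricted parts stay in the cell of their sample point and have total mass 1 - eta, so at
   most eta is moved between cells. *)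
have gU : \int[g]_z \1_(~` U) z <= eta.
  rewrite /Rintegral integral_indic ?setIT; [|exact: measurableT|exact: measurableC].
  rewrite [X in fine X](probability_setC g mU) fineB//; last exact: fin_num_measure.
  rewrite lerBlDr -lerBlDl -lee_fin fineK; last exact: fin_num_measure.
  rewrite gE.
  have r1 : r setT = 1 by rewrite /r [X in fine X](probability_setT mu).
  rewrite (_ : fine 1 - eta = (1 - eta) * r setT); last by rewrite r1 mulr1.
  rewrite -sum_cc// -sumEFin; apply: lee_sum => i _.
  have mhU : measurable (hh i @^-1` U) by rewrite -[X in measurable X]setTI; exact: mhh.
  rewrite mmE// lee_fin ler_wpM2l// -[leLHS]addr0 lerD//; last exact: mulr_ge0.
  rewrite ler_wpM2l// setTI (_ : _ `&` _ = cell (J (x i)))//.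
  apply/seteqP; split => [a []//|a ca]; split => //.
  by rewrite /U /hh/= inord_val /= ca.
have bd := bounded_mfun_cost sval_iso.
have D0 : 0 <= D by rewrite (le_trans _ (DX point point))// mdist_ge0.
apply: (@le_trans _ _ (\int[g]_z (e + D * \1_(~` U) z))).
  apply: mean_le => //.
    by apply: bounded_mfunD; [exact: bounded_mfun_cst|exact: bounded_mfunZ].
  move=> z; rewrite indicE; have [|] := boolP (z \in ~` U).
    by rewrite mulr1 => _; rewrite (le_trans (DX _ _))// lerDr.
  by rewrite mulr0 addr0 notin_setE => /contrapT; exact: Je.
rewrite meanD; [|exact: bounded_mfun_cst|exact: bounded_mfunZ].
by rewrite mean_cst meanZ// lerD2l mulrC ler_wpM2r.
Qed.

End exists_coupling.

(** A point is labelled by the first point of an e/2-net close to it; measurability follows by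
    induction on the net. *)
Lemma exists_small_cells {R : realType} (X : pmetricType R) (e : R) :
  compact [set: X] -> 0 < e -> exists (m : nat) (J : X -> nat),
  [/\ forall j, measurable (J @^-1` [set j] : set (borel X)), forall a, (J a < m)%N &
      forall a b, J a = J b -> mdist a b <= e].
Proof.
move=> cX e0; have [s sP] := finite_net cX (divr_gt0 e0 (@ltr0n R 2)).
exists (size s), (fun a => find (fun c => mdist c a < e / 2) s); split.
- elim: s {sP} => [|c s ih] j.
    rewrite (_ : _ @^-1` _ = if j == 0%N then setT else set0).
      by case: eqP.
    apply/seteqP; split => a /=; first by move=> <-.
    by case: eqP => // ->.
  pose B : set (borel X) := [set a : borel X | mdist c a < e / 2].
  have mB : measurable B.
    by apply: measurable_lt_set; exact: measurable_lipschitz (@lipschitz_mdistr _ _ c).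
  case: j => [|j].
    rewrite (_ : _ @^-1` _ = B)//; apply/seteqP.
    by split => a; rewrite /B/=; case: ifPn.
  rewrite (_ : _ @^-1` _ = ~` B `&`
    ((fun a => find (fun c => mdist c a < e / 2) s) @^-1` [set j])).
    by apply: measurableI; [exact: measurableC|exact: ih].
  apply/seteqP; split => a; rewrite /B/=; case: ifPn => //.
  - by move=> /negP ? [].
  - by move=> ? [].
  - by move=> ? [_ ->].
- by move=> a; rewrite -has_find; have [c cs ca] := sP a; apply/hasP; exists c.
- move=> a b ab; have fa : has (fun c => mdist c a < e / 2) s.
    by have [c cs ca] := sP a; apply/hasP; exists c.
  have fb : has (fun c => mdist c b < e / 2) s.
    by have [c cs cb] := sP b; apply/hasP; exists c.
  have := nth_find point fa; have := nth_find point fb; rewrite ab /=.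
  set c := nth _ _ _ => cb ca; have := metric_triangle a c b.
  by rewrite (metric_sym a c); lra.
Qed.

(** * A one-sided law of large numbers *)

(** The sharper bound 2 - 1/(N+1) telescopes. *)
Lemma sum_inv_sqr_le {R : realType} N : \sum_(k < N) k.+1%:R^-1 ^+ 2 <= 2 :> R.
Proof.
suff : \sum_(k < N.+1) k.+1%:R^-1 ^+ 2 <= 2 - N.+1%:R^-1 :> R.
  rewrite big_ord_recr/=; have : 0 <= N.+1%:R^-1 ^+ 2 :> R by exact: sqr_ge0.
  have : 0 <= N.+1%:R^-1 :> R by rewrite invr_ge0.
  by move: (N.+1%:R^-1) => t; lra.
elim: N => [|N ih]; first by rewrite big_ord1 invr1 expr1n; lra.
rewrite big_ord_recr/= (le_trans (lerD ih (lexx _)))// -lerBrDr.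
suff -> : (N.+1%:R^-1 : R) = N.+2%:R^-1 + N.+1%:R^-1 * N.+2%:R^-1.
  have : N.+2%:R^-1 <= N.+1%:R^-1 :> R by rewrite lef_pV2 ?posrE// ler_nat.
  have : 0 <= N.+2%:R^-1 :> R by rewrite invr_ge0.
  by move: (N.+1%:R^-1) (N.+2%:R^-1) => s t; nra.
have : 0 < N.+1%:R :> R by [].
rewrite -[N.+2%:R]natr1; move: (N.+1%:R : R) => t t0.
by field; rewrite !gt_eqF// addr_gt0.
Qed.

Lemma square_bracket n : exists k, (k.+1 ^ 2 <= n.+1 < k.+2 ^ 2)%N.
Proof.
elim: n => [|n [k /andP[kn nk]]]; first by exists 0%N.
have [nk'|nk'] := ltnP n.+2 (k.+2 ^ 2)%N; first by exists k; rewrite nk' (leq_trans kn).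
by exists k.+1; rewrite nk'/= (leq_ltn_trans nk)// ltn_sqr.
Qed.

Section one_sided_law_of_large_numbers.
Context {d d' : measure_display} {Omega : measurableType d}
  {T : measurableType d'} {R : realType} (P : probability Omega R).
Variables (mu : probability T R) (x : nat -> {RV P >-> T}).
Hypothesis x_iid : iid mu x.
Variable A : set T.
Hypothesis mA : measurable A.

Let Y i : Omega -> R := \1_(x i @^-1` A).

Let p := fine (mu A).

Let mxA i : measurable (x i @^-1` A).
Proof. by rewrite -[X in measurable X]setTI; exact: (measurable_funP (x i)). Qed.

Let bY i : bounded_mfun (Y i). Proof. exact/bounded_mfun_indic/mxA. Qed.

Let Y0 i w : 0 <= Y i w. Proof. by rewrite /Y indicE. Qed.

Let PxA i : P (x i @^-1` A) = mu A. Proof. by case: x_iid => _ /(_ i A mA). Qed.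

Let meanY i : \int[P]_w Y i w = p.
Proof. by rewrite /Rintegral integral_indic// setIT [X in fine X]PxA. Qed.

Let meanYY i j : i != j -> \int[P]_w (Y i w * Y j w) = p ^+ 2.
Proof.
move=> ij; rewrite (_ : (fun w => _) = \1_((x i @^-1` A) `&` (x j @^-1` A))); last first.
  by apply/funext => w; rewrite /Y indicI.
rewrite /Rintegral integral_indic//; last exact: measurableI.
rewrite setIT; case: x_iid => /(_ [fset i; j]%fset (fun=> A) (fun=> mA)) + _.
rewrite (_ : \bigcap_(k in _) _ = (x i @^-1` A) `&` (x j @^-1` A)); last first.
  apply/seteqP; split => [w h|w [wi wj] k /=].
    by split; apply: h; rewrite /= !inE eqxx ?orbT.
  by rewrite !inE => /orP[] /eqP ->.
move=> Pij; rewrite [X in fine X]Pij big_fsetU1 ?inE//= big_seq_fset1.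
rewrite [X in (X * _)%E]PxA [X in (_ * X)%E]PxA.
by rewrite -(fineK (fin_num_measure mu _ mA)).
Qed.

Let S n w := \sum_(i < n) Y i w.

Let bS n : bounded_mfun (S n). Proof. exact: bounded_mfun_sum. Qed.

Let p01 : 0 <= p <= 1.
Proof.
rewrite /p fine_ge0//= -lee_fin fineK; last exact: fin_num_measure.
exact: probability_le1.
Qed.

Let varS n : \int[P]_w ((S n w - n%:R * p) ^+ 2) <= n%:R.
Proof.
pose Z i w := Y i w - p.
have bZ i : bounded_mfun (Z i) by apply: bounded_mfunB => //; exact: bounded_mfun_cst.
have -> : \int[P]_w ((S n w - n%:R * p) ^+ 2) =
    \int[P]_w (\sum_(i < n) \sum_(j < n) Z i w * Z j w).
  apply: eq_Rintegral => w _.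
  have -> : S n w - n%:R * p = \sum_(i < n) Z i w.
    by rewrite big_split/= sumr_const card_ord mulNrn mulr_natl.
  by rewrite expr2 mulr_suml; apply: eq_bigr => i _; rewrite mulr_sumr.
rewrite mean_sum; last by move=> i; apply: bounded_mfun_sum => j; exact: bounded_mfunM.
have -> : n%:R = \sum_(i < n) (1 : R) by rewrite sumr_const card_ord.
apply: ler_sum => i _; rewrite mean_sum; last by move=> j; exact: bounded_mfunM.
rewrite (bigD1 i)//= big1 ?addr0.
  apply: mean_le_cst => [|w]; first exact: bounded_mfunM.
  by rewrite /Z /Y indicE; case: (_ \in _) => /=; case/andP: p01 => ? ?; nra.
move=> j ji; have -> : \int[P]_w (Z i w * Z j w) =
    \int[P]_w (Y i w * Y j w - (p * Y i w + p * Y j w - p ^+ 2)).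
  by apply: eq_Rintegral => w _; rewrite /Z; ring.
have bi := bounded_mfunZ p (bY i); have bj := bounded_mfunZ p (bY j).
have bij := bounded_mfunD bi bj; have bc := bounded_mfun_cst (T := Omega) (p ^+ 2).
rewrite meanB; [|exact: bounded_mfunM|exact: bounded_mfunB].
rewrite meanB// meanD// (meanZ P p (bY i)) (meanZ P p (bY j)) !meanY mean_cst.
rewrite meanYY; last by rewrite eq_sym.
by ring.
Qed.

(** The variance bound for [n] trials is only 1/n, which is not summable; along the squares it is
    1/(k+1)^2. *)
Let V k w := ((S (k.+1 ^ 2) w - (k.+1 ^ 2)%:R * p) / (k.+1 ^ 2)%:R) ^+ 2.

Let bV k : bounded_mfun (V k).
Proof.
apply: bounded_mfunX; apply: bounded_mfunM; last exact: bounded_mfun_cst.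
by apply: bounded_mfunB => //; exact: bounded_mfun_cst.
Qed.

Let meanV k : \int[P]_w V k w <= k.+1%:R^-1 ^+ 2.
Proof.
have -> : \int[P]_w V k w =
    (k.+1 ^ 2)%:R^-1 ^+ 2 * \int[P]_w ((S (k.+1 ^ 2) w - (k.+1 ^ 2)%:R * p) ^+ 2).
  rewrite -meanZ; last first.
    by apply: bounded_mfunX; apply: bounded_mfunB => //; exact: bounded_mfun_cst.
  by apply: eq_Rintegral => w _; rewrite /V exprMn mulrC.
apply: (le_trans (ler_wpM2l (sqr_ge0 _) (varS _))).
by rewrite expr2 -mulrA mulVf ?mulr1 ?pnatr_eq0 ?expn_eq0// natrX exprVn.
Qed.

(** The sum of the [V k] has finite mean, so it is finite almost surely and its terms tend to 0. *)
Lemma frequency_squares_ae : {ae P, forall w, V k w @[k --> \oo] --> 0}.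
Proof.
pose F k w := (V k w)%:E.
have mF k : measurable_fun setT (F k) by apply/measurable_EFinP; exact: (bV k).1.
have F0 k w : (0 <= F k w)%E by rewrite lee_fin sqr_ge0.
have : P.-integrable setT (fun w => \sum_(k <oo) F k w)%E.
  apply/integrableP; split; first by apply: ge0_emeasurable_sum => // i w _.
  under eq_integral do rewrite gee0_abs ?nneseries_ge0//.
  rewrite integral_nneseries//.
  apply: (@le_lt_trans _ _ 2%:E); last exact: ltry.
  apply: lime_le; first by apply: is_cvg_nneseries => i _ _; exact: integral_ge0.
  apply/nearW => N; rewrite big_mkord.
  under eq_bigr do rewrite integral_bounded//.
  rewrite sumEFin lee_fin (le_trans _ (sum_inv_sqr_le N))//.
  by apply: ler_sum => i _; exact: meanV.
move=> /integrable_ae => /(_ measurableT); apply: filterS => w /(_ I) Fw.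
apply: cvg_series_cvg_0; apply: nondecreasing_is_cvgn.
  by apply: nondecreasing_series => k _ _; exact: sqr_ge0.
exists (fine (\sum_(k <oo) F k w)%E) => _ [N _ <-].
rewrite -lee_fin fineK// /series/= -sumEFin.
by apply: nneseries_lim_ge => i _ _; exact: F0.
Qed.

(** Between consecutive squares the count [S] only grows, so its value at the lower square is a
    lower bound; the ratio of the squares tends to 1. The null set is independent of [eta]. *)
Lemma frequency_ge_ae : {ae P, forall w, forall eta, 0 < eta -> eta <= 1 ->
  \forall n \near \oo, (1 - eta) * p <= n.+1%:R^-1 * \sum_(i < n.+1) (x i w \in A)%:R}.
Proof.
apply: filterS frequency_squares_ae => w Vw eta eta0 eta1.
have SE n : \sum_(i < n) (x i w \in A)%:R = S n w.
  by apply: eq_bigr => i _; rewrite /Y indicE; congr (nat_of_bool _)%:R; rewrite /= !inE.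
case/andP: p01 => p0 p1; have [->|pn0] := eqVneq p 0.
  by apply/nearW => n; rewrite mulr0 mulr_ge0 ?invr_ge0// sumr_ge0.
have {}p0 : 0 < p by rewrite lt_neqAle eq_sym pn0.
(* Below this threshold the relative error at a square is at most eta/2. *)
have c0 : 0 < (eta / 2 * p) ^+ 2 by rewrite exprn_gt0// mulr_gt0// divr_gt0.
have [K1 _ K1P] := (@cvgr0_norm_lt _ _ _ _ _ _ Vw) _ c0.
(* With t = k+1 > 4/eta, t >= (1 - eta/4)(t + 1), so t^2 >= (1 - eta/2)(t + 1)^2; the other half of
   eta is spent at the square. *)
have [K2 _ K2P] := near_infty_natSinv_lt (PosNum (divr_gt0 eta0 (@ltr0n R 4))).
pose K := maxn K1 K2.
exists (K.+1 ^ 2)%N => // n /= Kn; rewrite SE.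
have [k /andP[kn nk]] := square_bracket n.
have Kk : (K <= k)%N.
  by rewrite -ltnS -ltnS -ltn_sqr (leq_ltn_trans _ nk)// (leq_trans Kn).
have Sk : (1 - eta / 2) * p * (k.+1 ^ 2)%:R <= S (k.+1 ^ 2) w.
  have := K1P k (leq_trans (leq_maxl _ _) Kk); rewrite /= /V.
  set m := (k.+1 ^ 2)%:R; have m0 : 0 < m :> R by rewrite ltr0n expn_gt0.
  rewrite ger0_norm ?sqr_ge0//; set u := _ / m => uc.
  have Su : S (k.+1 ^ 2) w = u * m + m * p by rewrite divfK ?gt_eqF// subrK.
  have : - (eta / 2 * p) <= u.
    have : 0 < eta / 2 * p by rewrite mulr_gt0// divr_gt0.
    move: uc; move: (eta / 2 * p) => c; rewrite leNgt => uc c1.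
    by apply/negP => uc'; nra.
  rewrite -(ler_pM2r m0) Su; lra.
have Sn : S (k.+1 ^ 2) w <= S n.+1 w.
  rewrite /S -(big_mkord xpredT (Y^~ w)) -(big_mkord xpredT (Y^~ w)).
  by rewrite [leRHS](big_cat_nat (leq0n _) kn)//= lerDl sumr_ge0.
rewrite [leRHS]mulrC ler_pdivlMr//; apply: (le_trans _ Sn); apply: (le_trans _ Sk).
have : n.+1%:R <= (k.+2 ^ 2)%:R :> R by rewrite ler_nat ltnW.
move=> nk'; apply: (@le_trans _ _ ((1 - eta) * p * (k.+2 ^ 2)%:R)).
  by rewrite ler_wpM2l// mulr_ge0 ?subr_ge0// ltW.
rewrite (mulrAC _ p) (mulrAC _ p) ler_pM2r// !natrX.
have kt : k.+1%:R^-1 < eta / 4 by exact: (K2P k (leq_trans (leq_maxr _ _) Kk)).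
have : 1 < eta / 4 * k.+1%:R by rewrite -ltr_pdivrMr// mul1r.
have : 1 <= k.+1%:R :> R by rewrite ler1n.
rewrite -[k.+2]addn1 natrD; move: (k.+1%:R : R) => t t1 et.
have h : (1 - eta / 4) * (t + 1) <= t by nra.
nra.
Qed.

End one_sided_law_of_large_numbers.

(** * The theorem *)

(** Each tolerance is attainable only from some [n] on, while one sequence must serve all of them:
    at [n] the choice meets the smallest tolerance 1/(k+1), k < n, that is attainable there. *)
Lemma exists_vanishing_choice {R : realType} (T : nat -> Type)
    (C : forall n, T n -> Prop) (F : forall n, T n -> \bar R) :
  (forall n t, 0 <= F n t)%E -> (forall n, exists t, C n t) ->
  (forall e : R, 0 < e -> \forall n \near \oo, exists t, C n t /\ (F n t <= e%:E)%E) ->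
  exists g : forall n, T n, (forall n, C n (g n)) /\ F n (g n) @[n --> \oo] --> 0%E.
Proof.
move=> F0 exC small.
have step n N : exists t, C n t /\ forall k, (k < N)%N ->
    (exists t', C n t' /\ (F n t' <= (k.+1%:R^-1)%:E)%E) -> (F n t <= (k.+1%:R^-1)%:E)%E.
  elim: N => [|N [t [Ct tN]]]; first by have [t Ct] := exC n; exists t.
  have [[t' [Ct' t'N]]|nN] := pselect (exists t', C n t' /\ (F n t' <= (N.+1%:R^-1)%:E)%E).
    exists t'; split => // k kN _; apply: (le_trans t'N).
    by rewrite lee_fin lef_pV2 ?posrE// ler_nat.
  exists t; split => // k; rewrite ltnS leq_eqVlt => /predU1P[->//|kN].
  exact: tN.
pose g n := sval (cid (step n n)); exists g.
have gP n : C n (g n) /\ forall k, (k < n)%N ->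
    (exists t', C n t' /\ (F n t' <= (k.+1%:R^-1)%:E)%E) -> (F n (g n) <= (k.+1%:R^-1)%:E)%E.
  exact: (svalP (cid (step n n))).
split => [n|]; first by case: (gP n).
have near_le e : 0 < e -> \forall n \near \oo, (F n (g n) <= e%:E)%E.
  move=> e0; have [k _ ke] := near_infty_natSinv_lt (PosNum e0).
  have {}ke : k.+1%:R^-1 < e by exact: (ke k (leqnn k)).
  have k0 : 0 < k.+1%:R^-1 :> R by rewrite invr_gt0.
  near=> n; apply: (@le_trans _ _ (k.+1%:R^-1)%:E); last by rewrite lee_fin ltW.
  have [_ gk] := gP n; apply: gk; first by near: n; exact: nbhs_infty_gt.
  by near: n; exact: small k0.
apply/fine_cvgP; split.
  apply: filterS (near_le 1 ltr01) => n Fn.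
  by rewrite ge0_fin_numE// (le_lt_trans Fn)// ltry.
apply/cvgrPdist_le => e e0; apply: filterS (near_le e e0) => n Fn /=.
rewrite sub0r normrN ger0_norm ?fine_ge0// -lee_fin fineK//.
by rewrite ge0_fin_numE// (le_lt_trans Fn)// ltry.
Unshelve. all: by end_near. Qed.

Theorem corollary6p15 (R : realType) (X : mmSpace R)
    (X_diff : lebesgue_differentiability X) (X_trace : trace_class X)
    (d : measure_display) (Omega : measurableType d) (P : probability Omega R)
    (x : nat -> {RV P >-> borel X}) (x_iid : iid (mm_measure X) x)
    (K : X -> X -> R) (K_out : is_cMDS_output_kernel K) :
  {ae P, forall w : Omega,
    let Xn (n : nat) : mmSpace R := sample_mm (fun i : 'I_n.+1 => x i w : X) in
    forall Kn : forall n : nat, Xn n -> Xn n -> R,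
      (forall n, is_cMDS_output_kernel (Kn n)) ->
      exists g : forall n, probability (borel X * borel (Xn n))%type R,
        (forall n, is_coupling (g n)) /\
        coupling_L2_distance (g n) K (Kn n) @[n --> \oo] --> 0%E}.
Proof.
pose t k : R := k.+1%:R^-1.
have t0 k : 0 < t k by rewrite invr_gt0.
have t1 k : t k <= 1 by rewrite invf_le1// ler1n.
have /choice[m /choice[J JP]] := fun k => exists_small_cells (@mm_compact _ X) (t0 k).
have [D [D0 DX]] := mdist_bounded (@mm_compact _ X).
(* All the randomness is in this event, a countable intersection over meshes and cells; for [w] in
   it the rest is deterministic, whatever kernels [Kn] are chosen. *)
have freq : {ae P, forall w, forall k j eta, 0 < eta -> eta <= 1 ->
    \forall n \near \oo, (1 - eta) * fine (mm_measure X (J k @^-1` [set j])) <=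
      n.+1%:R^-1 * \sum_(i < n.+1) (x i w \in (J k @^-1` [set j] : set (borel X)))%:R}.
  apply/ae_foralln => k; apply/ae_foralln => j; have [mJ _ _] := JP k.
  exact: (frequency_ge_ae x_iid (mJ j)).
case: K_out => lam [phi [sysX KE]].
have [CX sumX] := sum_eigenvalues_trace_class sysX X_trace.
apply: filterS freq => w freq Kn Kn_out.
pose Xn (n : nat) : mmSpace R := sample_mm (fun i : 'I_n.+1 => x i w : X).
have dist n (g : probability (borel X * borel (Xn n))%type R) (W : R) : is_coupling g ->
    coupling_cost (fun y : Xn n => sval y) g <= W ->
    (coupling_L2_distance g K (Kn n) <= (Num.sqrt (64 * D ^+ 3 * W))%:E)%E.
  move=> cg gW; have [kap [chi [sysY LE]]] := Kn_out n.
  have [CY sumY] := sum_eigenvalues_sample sysY.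
  have iso (a b : Xn n) : mdist (sval a : X) (sval b) = mdist a b by [].
  apply: (le_trans (coupling_L2_distance_le iso cg D0 DX sysX sysY sumX sumY KE LE)).
  have c0 : 0 <= coupling_cost (fun y : Xn n => sval y) g.
    by apply: Rintegral_ge0 => z _; exact: mdist_ge0.
  have D30 : 0 <= 64 * D ^+ 3 by rewrite mulr_ge0// exprn_ge0// ltW.
  rewrite poweR_EFin powR12_sqrt; last exact: mulr_ge0.
  rewrite lee_fin ler_wsqrtr//.
  by rewrite ler_wpM2l.
apply: (@exists_vanishing_choice R
  (fun n => probability (borel X * borel (Xn n))%type R) (fun n g => is_coupling g)
  (fun n g => coupling_L2_distance g K (Kn n))).
- by move=> n g; exact: Lnorm_ge0.
- move=> n; have [mJ Jm Je] := JP 0%N.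
  (* With eta = 1 the frequency condition is trivial, so some coupling exists for every [n]. *)
  have [|||g [cg _]] := @exists_coupling _ X n (fun i => x i w) (J 0%N) (m 0%N)
    (t 0%N) 1 D mJ Jm Je _ DX _ _ => //; last by exists g.
  + exact: ltW.
  + by move=> j; rewrite subrr mul0r mulr_ge0 ?invr_ge0// sumr_ge0.
(* Mesh and defect are both taken to be [t k], so the cost is at most [t k] times 1 + D. *)
- move=> e e0; have c0 : 0 < 64 * D ^+ 3 * (1 + D).
    by rewrite !mulr_gt0// ?exprn_gt0// addr_gt0.
  have [k _ kP] := near_infty_natSinv_lt (PosNum (divr_gt0 (exprn_gt0 2 e0) c0)).
  have {}kP : t k < e ^+ 2 / (64 * D ^+ 3 * (1 + D)) by exact: (kP k (leqnn k)).
  have [mJ Jm Je] := JP k.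
  (* One threshold on [n] serves the finitely many labels below [m k]; the other cells are empty. *)
  have freq_k : \forall n \near \oo, forall j, (j < m k)%N ->
      (1 - t k) * fine (mm_measure X (J k @^-1` [set j])) <=
      n.+1%:R^-1 * \sum_(i < n.+1) (x i w \in (J k @^-1` [set j] : set (borel X)))%:R.
    elim: (m k) => [|M ih]; first exact: nearW.
    apply: filterS2 ih (freq k M _ (t0 k) (t1 k)) => n nM nM' j.
    by rewrite ltnS leq_eqVlt => /predU1P[->|/nM].
  apply: filterS freq_k => n nfreq.
  have [|||g [cg gW]] := @exists_coupling _ X n (fun i => x i w) (J k) (m k)
    (t k) (t k) D mJ Jm Je _ DX _ _ => //.
  + exact: ltW.
  + move=> j; have [jm|mj] := ltnP j (m k).
      rewrite (le_trans (nfreq j jm))// ler_wpM2l ?invr_ge0//.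
      by apply: ler_sum => i _; rewrite ler_nat; case: (boolP (_ \in _)) => //; rewrite inE/= => ->; rewrite eqxx.
    rewrite (_ : cell _ _ = set0); last first.
      by apply/seteqP; split => // a /= aj; have := Jm a; rewrite aj ltnNge mj.
    by rewrite measure0 mulr0 mulr_ge0 ?invr_ge0// sumr_ge0.
  exists g; split => //; apply: (le_trans (dist n g _ cg gW)).
  rewrite lee_fin -[leRHS]gtr0_norm// -sqrtr_sqr ler_wsqrtr//.
  move: kP; rewrite ltr_pdivlMr// => /ltW; apply: le_trans.
  by rewrite le_eqVlt; apply/orP; left; apply/eqP; ring.
Qed.
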